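(* Let $k<n$ be positive integers and let $\widehat\Sigma\in\mathbb{R}^{n\times n}$ be a symmetric strictly positive definite matrix. Then $$\min_{H,D}\ \mathcal I(\widehat\Sigma\,\|\,HH^\top+D)=\min_{\Sigma_0\in\mathbf\Sigma_0,\ \Sigma_1\in\mathbf\Sigma_1}\mathcal I(\Sigma_0\|\Sigma_1),$$ where on the left-hand side the minimum is over all $H\in\mathbb{R}^{n\times k}$ and all diagonal $D\in\mathbb{R}^{n\times n}$ with $D\ge 0$ (both minima being attained).
   Context: For two covariance (symmetric nonnegative definite) matrices $\Sigma_1,\Sigma_2$ of the same size $m\times m$, $\mathcal I(\Sigma_1\|\Sigma_2)$ denotes the I-divergence (Kullback-Leibler divergence) $\mathcal I(\nu_1\|\nu_2)=\mathbb E_{\nu_1}\log\frac{d\nu_1}{d\nu_2}$ between the zero mean normal laws $\nu_i=N(0,\Sigma_i)$, equal to $+\infty$ if $\nu_1\not\ll\nu_2$. If both matrices are strictly positive definite, $\mathcal I(\Sigma_1\|\Sigma_2)=\frac12\log\frac{|\Sigma_2|}{|\Sigma_1|}-\frac m2+\frac12\mathrm{tr}(\Sigma_2^{-1}\Sigma_1)$. $\mathbf\Sigma$ is the set of all $(n+k)\times(n+k)$ covariance matrices, written in blocks $\Sigma=\begin{pmatrix}\Sigma_{11}&\Sigma_{12}\\ \Sigma_{21}&\Sigma_{22}\end{pmatrix}$ with $\Sigma_{11}$ of size $n\times n$ and $\Sigma_{22}$ of size $k\times k$. $\mathbf\Sigma_0=\{\Sigma\in\mathbf\Sigma:\Sigma_{11}=\widehat\Sigma\}$.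 $\mathbf\Sigma_1$ is the set of all matrices of the form $\Sigma(H,D,Q)=\begin{pmatrix}HH^\top+D&HQ\\ (HQ)^\top&Q^\top Q\end{pmatrix}$ with $H\in\mathbb{R}^{n\times k}$, $D\in\mathbb{R}^{n\times n}$ diagonal with $D\ge0$, and $Q\in\mathbb{R}^{k\times k}$ invertible. *)

(* Defs.v *)
From HB Require Import structures.
From mathcomp Require Import all_boot all_order all_algebra.
From mathcomp Require Import all_classical all_reals all_analysis.
From mathcomp Require Import ring.

Set Implicit Arguments.
Unset Strict Implicit.
Unset Printing Implicit Defensive.

Import Order.TTheory GRing.Theory Num.Theory.
Import numFieldNormedType.Exports.

Local Open Scope classical_set_scope.
Local Open Scope ring_scope.

Section Covariance.
Context {R : realType}.

Definition covariance_mx m (S : 'M[R]_m) : Prop :=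
  S^T = S /\ forall u : 'cV[R]_m, 0 <= (u^T *m S *m u) 0 0.

Definition posdef_mx m (S : 'M[R]_m) : Prop :=
  S^T = S /\ forall u : 'cV[R]_m, u != 0 -> 0 < (u^T *m S *m u) 0 0.

(* Cholesky factor, lower triangular, with S = L *m L^T for every covariance
   matrix S, see cholP.  A null pivot gives a null column, since 0^-1 = 0. *)
Fixpoint chol m : 'M[R]_m -> 'M[R]_m :=
  match m with
  | 0 => fun=> 0
  | p.+1 => fun S : 'M[R]_(1 + p) =>
      let a := S 0 0 in
      block_mx (Num.sqrt a)%:M 0
               ((Num.sqrt a)^-1 *: dlsubmx S)
               (chol (drsubmx S - a^-1 *: (dlsubmx S *m ursubmx S)))
  end.

Lemma covariance_block p (S : 'M[R]_(1 + p)) : covariance_mx S ->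
  let a := S 0 0 in
  [/\ 0 <= a, ursubmx S = (dlsubmx S)^T, a = 0 -> dlsubmx S = 0 &
      covariance_mx (drsubmx S - a^-1 *: (dlsubmx S *m ursubmx S))].
Proof.
move=> [Ssym Spos] a.
set b := dlsubmx S; set C := drsubmx S.
have Eul : ulsubmx S = a%:M.
  by apply/matrixP => i j; rewrite !ord1 !mxE /= mulr1n; congr (S _ _); apply/val_inj.
have Eur : ursubmx S = b^T by rewrite /b trmx_dlsub Ssym.
have EC : C^T = C by rewrite /C trmx_drsub Ssym.
have ES : S = block_mx a%:M b^T b C by rewrite -Eul -Eur submxK.
have Es w : w^T *m b = ((w^T *m b) 0 0)%:M by rewrite [LHS]mx11_scalar.
have Es' (w : 'cV_p) : b^T *m w = ((w^T *m b) 0 0)%:M.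
  by rewrite -[b^T *m w]trmxK trmx_mul trmxK [in LHS]Es tr_scalar_mx.
have quad (t : R) (w : 'cV[R]_p) :
    0 <= t ^+ 2 * a + 2 * t * (w^T *m b) 0 0 + (w^T *m C *m w) 0 0.
  have /= := Spos (col_mx (t%:M : 'M[R]_1) w).
  rewrite {1}ES tr_col_mx mul_row_block mul_row_col !mulmxDl tr_scalar_mx.
  rewrite -[t%:M *m b^T *m w]mulmxA Es' [in w^T *m b *m _]Es -!scalar_mxM.
  set s := (w^T *m b) 0 0; set q := w^T *m C *m w.
  rewrite !mxE eqxx !mulr1n => h.
  by apply: le_trans h _; rewrite le_eqVlt; apply/orP; left; apply/eqP; ring.
have a0 : 0 <= a.
  by have := quad 1 0; rewrite trmx0 !mul0mx !mxE expr1n mul1r mulr0 !addr0.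
have ab0 : a = 0 -> b = 0.
  move=> az; apply/colP => i; rewrite [RHS]mxE.
  pose s := (b^T *m b) 0 0; pose q := (b^T *m C *m b) 0 0.
  have hq (t : R) : 0 <= 2 * t * s + q.
    by have := quad t b; rewrite az mulr0 add0r.
  have s_ge0 : 0 <= s.
    by rewrite /s mxE sumr_ge0 // => j _; rewrite mxE -expr2 sqr_ge0.
  have s0 : s = 0.
    apply/eqP; rewrite eq_le s_ge0 andbT leNgt; apply/negP => sp.
    have := hq (- (q + 1) / (2 * s)).
    have -> : 2 * (- (q + 1) / (2 * s)) * s + q = -1.
      by field; rewrite gt_eqF.
    by rewrite oppr_ge0 ler10.
  have := s0; rewrite /s mxE => /eqP.
  rewrite psumr_eq0 => [/allP/(_ i)|j _]; last by rewrite mxE -expr2 sqr_ge0.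
  rewrite mem_index_enum mxE -expr2 sqrf_eq0 => /(_ isT) /=.
  by move=> /eqP.
split=> //; split.
  by rewrite linearB /= linearZ /= EC trmx_mul Eur trmxK.
move=> w; rewrite Eur mulmxBr mulmxBl -scalemxAr -scalemxAl mulmxA.
rewrite -(mulmxA (w^T *m b)) Es' {1}Es -scalar_mxM.
have := quad (- (w^T *m b) 0 0 / a) w; have := quad 0 w.
set s := (w^T *m b) 0 0; set q := w^T *m C *m w => q0 qs.
have -> : (q - a^-1 *: (s * s)%:M) 0 0 = q 0 0 - a^-1 * (s * s).
  by rewrite !mxE eqxx mulr1n.
have [az|an0] := eqVneq a 0.
  by move: q0; rewrite az invr0 mul0r subr0 expr0n /= mul0r mulr0 mul0r !add0r.
suff -> : q 0 0 - a^-1 * (s * s) =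
  (- s / a) ^+ 2 * a + 2 * (- s / a) * s + q 0 0 by [].
by field.
Qed.

Lemma cholP m (S : 'M[R]_m) : covariance_mx S -> chol S *m (chol S)^T = S.
Proof.
elim: m S => [|p IH]; first by move=> S _; apply/matrixP => -[].
suff H (S : 'M[R]_(1 + p)) : covariance_mx S -> chol S *m (chol S)^T = S by [].
move=> /covariance_block /=.
set a := S 0 0 => -[a0 Eur ab0 /IH EC].
rewrite -[RHS](@submxK _ 1 p 1 p) /=; set b := dlsubmx S in Eur ab0 EC *.
rewrite (@tr_block_mx _ 1 p 1 p) (@mulmx_block _ 1 p 1 p 1 p).
rewrite !trmx0 !mul0mx !mulmx0 !addr0 EC tr_scalar_mx -scalar_mxM.
rewrite -expr2 sqr_sqrtr // Eur linearZ /=.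
rewrite mul_scalar_mx mul_mx_scalar !scalerA -scalemxAl -scalemxAr scalerA.
have -> : (Num.sqrt a)^-1 * (Num.sqrt a)^-1 = a^-1.
  by rewrite -invfM -expr2 sqr_sqrtr.
rewrite addrCA subrr addr0; congr block_mx.
- apply/matrixP => i j; rewrite !ord1 !mxE /= mulr1n.
  by congr (S _ _); apply/val_inj.
- have [az|an0] := eqVneq a 0; first by rewrite ab0 // trmx0 scaler0.
  by rewrite mulfV ?scale1r // sqrtr_eq0 -ltNge lt_neqAle eq_sym an0.
- have [az|an0] := eqVneq a 0; first by rewrite ab0 // scaler0.
  by rewrite mulfV ?scale1r // sqrtr_eq0 -ltNge lt_neqAle eq_sym an0.
Qed.

End Covariance.

(* Vectors of R^m carry the type m.-tuple R, which the library equips with the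
   product sigma-algebra. *)
Section NormalLaw.
Context {R : realType}.

(* normal_prob is a measure on measurableTypeR R, i.e. R under another display *)
Definition cons_pair n (x : measurableTypeR R * n.-tuple R) : n.+1.-tuple R :=
  [tuple of x.1 :: x.2].

Lemma measurable_cons_pair n : measurable_fun [set: _] (@cons_pair n).
Proof. exact: measurable_cons. Qed.

HB.instance Definition _ n :=
  isMeasurableFun.Build _ _ _ _ (@cons_pair n) (@measurable_cons_pair n).

(* law of n independent N(0, 1) variables *)
Fixpoint std_normal n : probability (n.-tuple R) R :=
  match n with
  | 0 => \d_([tuple] : 0.-tuple R)
  | p.+1 => distribution (normal_prob 0 1 \x std_normal p)%E (@cons_pair p)
  end.

Definition mx_act m n (A : 'M[R]_(m, n)) (x : n.-tuple R) : m.-tuple R :=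
  [tuple \sum_(j < n) A i j * tnth x j | i < m].

Lemma measurable_mx_act m n (A : 'M[R]_(m, n)) :
  measurable_fun [set: _] (mx_act A).
Proof.
apply/measurable_fun_tnthP => i.
rewrite (_ : _ \o _ = fun x => \sum_(j < n) A i j * tnth x j); last first.
  by apply/funext => x /=; rewrite tnth_mktuple.
apply: measurable_sum => j; apply: measurable_realfun.measurable_funM => //.
exact: measurable_tnth.
Qed.

HB.instance Definition _ m n (A : 'M[R]_(m, n)) :=
  isMeasurableFun.Build _ _ _ _ (mx_act A) (measurable_mx_act A).

(* N(0, S), possibly degenerate: the law of L Z with Z standard normal and
   L L^T = S. *)
Definition normal_law m (S : 'M[R]_m) : probability (m.-tuple R) R :=
  distribution (std_normal m) (mx_act (chol S)).

End NormalLaw.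

Local Open Scope ereal_scope.
Local Open Scope charge_scope.

(* The integral is that of the positive part minus that of the negative part;
   the latter is always finite here, since t * ln t is bounded below. *)
Definition KL d (T : measurableType d) (R : realType) (P Q : probability T R)
    : \bar R :=
  if `[< P `<< Q >] then
    \int[P]_x lne ('d (charge_of_finite_measure P) '/d Q x)
  else +oo.

Definition Idiv (R : realType) m (S1 S2 : 'M[R]_m) : \bar R :=
  KL (normal_law S1) (normal_law S2).

Definition is_min (R : realType) (A : set (\bar R)) (v : \bar R) : Prop :=
  A v /\ lbound A v.

Local Close Scope charge_scope.
Local Close Scope ereal_scope.

(* a diagonal matrix is nonnegative definite iff its diagonal is nonnegative *)
Definition nonneg_diag (R : realType) n (D : 'M[R]_n) : Prop :=
  is_diag_mx D /\ forall i, 0 <= D i i.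

Definition Sigma0 (R : realType) n k (Shat : 'M[R]_n) : set 'M[R]_(n + k) :=
  [set S | covariance_mx S /\ ulsubmx S = Shat].

Definition SigmaHDQ (R : realType) n k
    (H : 'M[R]_(n, k)) (D : 'M[R]_n) (Q : 'M[R]_k) : 'M[R]_(n + k) :=
  block_mx (H *m H^T + D) (H *m Q) ((H *m Q)^T) (Q^T *m Q).

Definition Sigma1 (R : realType) n k : set 'M[R]_(n + k) :=
  [set S | exists (H : 'M[R]_(n, k)) (D : 'M[R]_n) (Q : 'M[R]_k),
     [/\ nonneg_diag D, Q \in unitmx & S = SigmaHDQ H D Q]].

Arguments Sigma0 {R n} k Shat.
Arguments Sigma1 R n k : clear implicits.

(* Main.v *)
Require Import Defs.
From mathcomp Require Import all_boot all_order all_algebra.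
From mathcomp Require Import all_classical all_reals all_analysis.
From mathcomp Require Import measurable_realfun.
From mathcomp Require Import ring lra.

Set Implicit Arguments.
Unset Strict Implicit.
Unset Printing Implicit Defensive.

Import Order.TTheory GRing.Theory Num.Theory.
Import numFieldNormedType.Exports.

Local Open Scope classical_set_scope.
Local Open Scope ring_scope.

(* For nonsingular S1 and S2, the divergence of N(0, S1) from N(0, S2) is
   - ln det A + (|A|^2 - m) / 2 with |A| the Frobenius norm and
   A = (chol S2)^-1 chol S1, which is lower triangular with positive diagonal; it is
   infinite when only S2 is singular.  As a function of A it is coercive, so it
   attains its minimum over the matrices S2 = H H^T + D.

   Projecting on the first n coordinates does not increase the divergence (data
   processing), hence I(S0 || Sigma(H, D, Q)) >= I(Shat || H H^T + D).  Equality
   holds when S0 has marginal Shat and the same conditional law of the last k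
   coordinates given the first n ones as N(0, Sigma(H, D, Q)): the density of one
   law with respect to the other is then a function of the first n coordinates,
   also when D, and with it both laws, is singular. *)

(** Lower triangular factors let everything be done one coordinate at a time. A triangular affine
    change of variables follows from the one-dimensional one by Tonelli's theorem, with the standard
    normal law as reference measure in every dimension. The leading block of [chol S] is the factor
    of the leading block of [S], so marginal and conditional laws are read off blocks.

    The obstacle to the existence of a minimum is that H and D range over an unbounded set, which
    moreover contains singular models. A sublevel set of the divergence bounds A and keeps its
    diagonal away from 0. Once S2 is whitened, the relation S2 = H H^T + D becomes a polynomial
    equation in A, D and the transformed H, and its diagonal entries bound the two remaining
    unknowns. What is left is compact. *)

Lemma normr_le_1Dsqr (R : realType) (x : R) : `|x| <= 1 + x ^+ 2.
Proof.
rewrite ler_norml; have := sqr_ge0 (x - 2^-1); have := sqr_ge0 (x + 2^-1) => ? ?.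
by apply/andP; split; lra.
Qed.

(** * Triangular matrices and uniqueness of the Cholesky factor *)

Section Triangular.
Context {R : realType}.

Lemma trig_mulmx m (A B : 'M[R]_m) :
  is_trig_mx A -> is_trig_mx B -> is_trig_mx (A *m B).
Proof.
move=> /is_trig_mxP tA /is_trig_mxP tB; apply/is_trig_mxP => i j ij.
rewrite mxE big1 // => l _; have [il|li] := ltnP i l.
  by rewrite tA // mul0r.
by rewrite tB ?mulr0 // (leq_ltn_trans li).
Qed.

Lemma trig_mulmx_diag m (A B : 'M[R]_m) i :
  is_trig_mx A -> is_trig_mx B -> (A *m B) i i = A i i * B i i.
Proof.
move=> /is_trig_mxP tA /is_trig_mxP tB; rewrite mxE (bigD1 i) //= big1 ?addr0 //.
move=> l; rewrite neq_ltn => /orP[li|il]; last by rewrite tA // mul0r.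
by rewrite tB // mulr0.
Qed.

Lemma trig_unitmx m (A : 'M[R]_m) :
  is_trig_mx A -> (A \in unitmx) = [forall i, A i i != 0].
Proof.
move=> tA; rewrite unitmxE det_trig // unitfE.
apply/prodf_neq0/forallP => [h i|h i _]; exact: h.
Qed.

(** Forward substitution: in the entry (i, j) of A A^-1 = 1 with i < j, the terms beyond the
    diagonal of A vanish and those of index below i vanish by induction on the row, which leaves A i
    i times the entry sought. *)
Lemma trig_invmx m (A : 'M[R]_m) :
  A \in unitmx -> is_trig_mx A -> is_trig_mx (invmx A).
Proof.
move=> uA tA; have /is_trig_mxP tA' := tA; apply/is_trig_mxP => i j ij.
have /forallP dA : [forall i, A i i != 0] by rewrite -trig_unitmx.
have [N] := ubnP (val i); elim: N => // N IH in i ij *; rewrite ltnS => iN.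
have : (A *m invmx A) i j = 0.
  by rewrite mulmxV // mxE; case: eqVneq ij => // ->; rewrite ltnn.
rewrite mxE (bigD1 i) //= big1 ?addr0 => [|l].
  by move=> /eqP; rewrite mulf_eq0 (negbTE (dA i)) => /eqP.
rewrite neq_ltn => /orP[li|il]; last by rewrite tA' // mul0r.
by rewrite IH ?mulr0 //; [exact: ltn_trans ij|exact: leq_trans iN].
Qed.

Lemma trig_invmx_diag m (A : 'M[R]_m) i :
  A \in unitmx -> is_trig_mx A -> (invmx A) i i = (A i i)^-1.
Proof.
move=> uA tA; have /forallP/(_ i) dA : [forall i, A i i != 0].
  by rewrite -trig_unitmx.
apply: (mulfI dA); rewrite mulfV // -trig_mulmx_diag ?trig_invmx //.
by rewrite mulmxV // mxE eqxx.
Qed.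

Definition pos_diag m (A : 'M[R]_m) : Prop := forall i, 0 < A i i.

Lemma trig_pos_unitmx m (A : 'M[R]_m) :
  is_trig_mx A -> pos_diag A -> A \in unitmx.
Proof. by move=> tA dA; rewrite trig_unitmx //; apply/forallP => i; rewrite gt_eqF. Qed.

(* The matrices in the range of [chol]. *)
Definition chol_form m (T : 'M[R]_m) : Prop :=
  [/\ is_trig_mx T, forall i, 0 <= T i i & forall i j, T j j = 0 -> T i j = 0].

Lemma pos_diag_chol_form m (T : 'M[R]_m) :
  is_trig_mx T -> pos_diag T -> chol_form T.
Proof. by move=> tT pT; split=> // [i|i j]; [exact: ltW|move/eqP; rewrite gt_eqF]. Qed.

Lemma chol_form_block n k (A : 'M[R]_n) (B : 'M[R]_(k, n)) (C : 'M[R]_k) :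
  is_trig_mx A -> pos_diag A -> chol_form C -> chol_form (block_mx A 0 B C).
Proof.
move=> tA pA [tC dC zC]; split=> [|i|i j].
- by rewrite is_trig_block_mx // eqxx tA tC.
- by case: (split_ordP i) => l ->; rewrite ?block_mxEul ?block_mxEdr // ltW.
- case: (split_ordP j) => l ->.
    by rewrite block_mxEul => /eqP; rewrite gt_eqF.
  rewrite block_mxEdr => /zC z; case: (split_ordP i) => p ->.
    by rewrite block_mxEur mxE.
  by rewrite block_mxEdr.
Qed.

Lemma chol_form_sub n k (T : 'M[R]_(n + k)) : chol_form T ->
  [/\ chol_form (ulsubmx T), chol_form (drsubmx T) & ursubmx T = 0].
Proof.
move=> [tT dT zT]; split; last exact: ursubmx_trig.
- split=> [|i|i j]; rewrite ?ulsubmx_trig // !mxE; first exact: dT.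
  exact: zT.
- split=> [|i|i j]; rewrite ?drsubmx_trig // !mxE; first exact: dT.
  exact: zT.
Qed.

(** No assumption on S: [Num.sqrt] is nonnegative, being 0 on negative numbers, and 0^-1 = 0 turns a
    null pivot into a null column. *)
Lemma chol_chol_form m (S : 'M[R]_m) : chol_form (chol S).
Proof.
elim: m S => [|p IH] S; first by split=> [|[]|[]] //; apply/is_trig_mxP => -[].
change (@chol_form (1 + p) (block_mx (Num.sqrt (S 0 0))%:M 0
  ((Num.sqrt (S 0 0))^-1 *: @dlsubmx _ 1 p 1 p S)
  (chol (@drsubmx _ 1 p 1 p S -
     (S 0 0)^-1 *: (@dlsubmx _ 1 p 1 p S *m @ursubmx _ 1 p 1 p S))))).
have [tC dC zC] := IH (@drsubmx _ 1 p 1 p S -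
     (S 0 0)^-1 *: (@dlsubmx _ 1 p 1 p S *m @ursubmx _ 1 p 1 p S)).
split=> [|i|i j].
- by rewrite is_trig_block_mx // eqxx tC mx11_is_trig.
- case: (split_ordP i) => l ->; rewrite ?block_mxEul ?block_mxEdr //.
  by rewrite mxE eqxx mulr1n sqrtr_ge0.
- case: (split_ordP j) => l ->.
    rewrite block_mxEul mxE eqxx mulr1n => s0.
    case: (split_ordP i) => q ->; rewrite ?block_mxEul ?block_mxEdl.
      by rewrite mxE s0 mul0rn.
    by rewrite mxE s0 invr0 mul0r.
  rewrite block_mxEdr => /zC z; case: (split_ordP i) => q ->.
    by rewrite block_mxEur mxE.
  by rewrite block_mxEdr.
Qed.

(** The first column of T T^T is t times that of T, so it determines t >= 0, then b by division, and
    the Schur complement is T' T'^T. When t = 0 the division is void, but then b = 0. This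
    identifies [chol] from any factorization of the right form, as needed for leading blocks,
    whitened matrices and lifted laws. *)
Lemma chol_uniq m (T : 'M[R]_m) : chol_form T -> chol (T *m T^T) = T.
Proof.
elim: m T => [|p IH]; first by move=> T _; apply/matrixP => -[].
suff H (T : 'M[R]_(1 + p)) : chol_form T -> chol (T *m T^T) = T by [].
move=> /[dup] -[_ dT zT] /chol_form_sub[_ cT' ur0].
set T' := drsubmx T in cT'; set b := dlsubmx T; set t := T 0 0.
have Eul : ulsubmx T = t%:M.
  by apply/matrixP => i j; rewrite !ord1 !mxE /= mulr1n; congr (T _ _); apply/val_inj.
have ET : T = block_mx t%:M 0 b T' by rewrite -Eul -ur0 submxK.
have t0 : 0 <= t by exact: dT.
have bz : t = 0 -> b = 0.
  move=> tz; apply/matrixP => i j; rewrite !ord1 !mxE.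
  by apply: zT; rewrite -tz; congr (T _ _); exact/val_inj.
have ES : T *m T^T =
    block_mx (t * t)%:M (t *: b^T) (t *: b) (b *m b^T + T' *m T'^T).
  rewrite {1 2}ET tr_block_mx mulmx_block !trmx0 !mul0mx !mulmx0 !addr0.
  by rewrite tr_scalar_mx -scalar_mxM mul_scalar_mx mul_mx_scalar.
rewrite /= -/(1 + p)%N.
have -> : (T *m T^T) 0 0 = t ^+ 2.
  rewrite ES (_ : 0 = lshift p 0 :> 'I_(1 + p)); last exact/val_inj.
  by rewrite block_mxEul mxE eqxx mulr1n.
rewrite ES block_mxKdl block_mxKdr block_mxKur sqrtr_sqr ger0_norm //.
rewrite [RHS]ET scalerA; congr block_mx.
  have [tz|tn0] := eqVneq t 0; first by rewrite bz // scaler0.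
  by rewrite mulVf // scale1r.
rewrite -scalemxAl -scalemxAr !scalerA.
have -> : (t ^+ 2)^-1 * t * t *: (b *m b^T) = b *m b^T.
  have [tz|tn0] := eqVneq t 0; first by rewrite bz // mul0mx scaler0.
  by rewrite -mulrA -expr2 mulVf ?scale1r // expf_neq0.
by rewrite addrC addKr IH.
Qed.

End Triangular.

(** * Positive definiteness read on the Cholesky factor *)

Section PositiveDefinite.
Context {R : realType}.

Lemma quad_gram m n (L : 'M[R]_(m, n)) (u : 'cV[R]_m) :
  (u^T *m (L *m L^T) *m u) 0 0 = \sum_i ((L^T *m u) i 0) ^+ 2.
Proof.
rewrite mulmxA -mulmxA -[u^T *m L]trmxK trmx_mul trmxK mxE.
by apply: eq_bigr => i _; rewrite mxE expr2.
Qed.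

Lemma quad_gram_ge0 m n (L : 'M[R]_(m, n)) (u : 'cV[R]_m) :
  0 <= (u^T *m (L *m L^T) *m u) 0 0.
Proof. by rewrite quad_gram sumr_ge0 // => i _; exact: sqr_ge0. Qed.

Lemma quad_gram_eq0 m n (L : 'M[R]_(m, n)) (u : 'cV[R]_m) :
  (u^T *m (L *m L^T) *m u) 0 0 = 0 -> L^T *m u = 0.
Proof.
rewrite quad_gram => /eqP; rewrite psumr_eq0 => [/allP h|i _]; last exact: sqr_ge0.
apply/colP => i; have := h i; rewrite mem_index_enum sqrf_eq0 => /(_ isT)/eqP ->.
by rewrite mxE.
Qed.

Lemma gram_covariance m n (L : 'M[R]_(m, n)) : covariance_mx (L *m L^T).
Proof. by split=> [|u]; [rewrite trmx_mul trmxK|exact: quad_gram_ge0]. Qed.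

Lemma posdef_covariance m (S : 'M[R]_m) : posdef_mx S -> covariance_mx S.
Proof.
move=> [St Sp]; split=> // u; have [->|/Sp/ltW//] := eqVneq u 0.
by rewrite mulmx0 mxE.
Qed.

Lemma covariance_ulsub n k (S : 'M[R]_(n + k)) :
  covariance_mx S -> covariance_mx (ulsubmx S).
Proof.
move=> cS; have [St _] := cS; have EL := cholP cS.
split=> [|u]; first by rewrite trmx_ulsub St.
have -> : ulsubmx S = usubmx (chol S) *m (usubmx (chol S))^T.
  by rewrite -{1}EL -{1 2}[chol S]vsubmxK tr_col_mx mul_col_row block_mxKul.
exact: quad_gram_ge0.
Qed.

(** Since the upper right block of L is null, the leading block of L L^T involves only the leading
    block of L; uniqueness concludes. *)
Lemma chol_ulsub n k (S : 'M[R]_(n + k)) : covariance_mx S ->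
  ulsubmx (chol S) = chol (ulsubmx S).
Proof.
move=> cS; have [cul _ ur0] := chol_form_sub (chol_chol_form S).
rewrite -[LHS](chol_uniq cul); congr chol.
rewrite -[S in RHS](cholP cS); set L := chol S in ur0 *.
have -> : L *m L^T = block_mx (ulsubmx L) 0 (dlsubmx L) (drsubmx L) *m
    (block_mx (ulsubmx L) 0 (dlsubmx L) (drsubmx L))^T by rewrite -ur0 submxK.
by rewrite tr_block_mx mulmx_block block_mxKul mul0mx addr0.
Qed.

(** With S = L L^T the quadratic form at u is the squared norm of L^T u, so it vanishes exactly on
    the kernel of L^T. *)
Lemma covariance_posdef_unit m (S : 'M[R]_m) :
  covariance_mx S -> (posdef_mx S <-> chol S \in unitmx).
Proof.
move=> cS; have EL := cholP cS; split=> [[_ Sp]|uL]; last first.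
  split=> [|u u0]; first by case: cS.
  rewrite lt_neqAle eq_sym; have [_ -> ] := cS; rewrite andbT -EL.
  apply: contra_neq u0 => /quad_gram_eq0 h.
  by rewrite -[u](mulKmx (_ : (chol S)^T \in unitmx)) ?unitmx_tr // h mulmx0.
rewrite -row_free_unit -kermx_eq0; apply/eqP/row_matrixP => i.
rewrite row0; set w := row i _.
have wL : w *m chol S = 0 by apply/sub_kermxP; exact: row_sub.
apply/eqP; rewrite -[w]trmxK trmx_eq0; apply/negPn/negP => /Sp.
by rewrite -{1}EL trmxK mulmxA wL !mul0mx mxE ltxx.
Qed.

Lemma posdef_chol m (S : 'M[R]_m) : posdef_mx S -> pos_diag (chol S).
Proof.
move=> Sp; have [tL dL _] := chol_chol_form S.
have := Sp; rewrite covariance_posdef_unit; last exact: posdef_covariance.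
rewrite trig_unitmx // => /forallP h i.
by rewrite lt_neqAle eq_sym h dL.
Qed.

Lemma not_posdef_null m (S : 'M[R]_m) : covariance_mx S -> ~ posdef_mx S ->
  exists2 u : 'cV[R]_m, u != 0 & u^T *m chol S = 0.
Proof.
move=> cS; rewrite covariance_posdef_unit // -row_free_unit -kermx_eq0.
move=> /negP/rowV0Pn[v /sub_kermxP vL v0]; exists v^T; first by rewrite trmx_eq0.
by rewrite trmxK.
Qed.

End PositiveDefinite.

Local Open Scope ereal_scope.

(** * Integration against a measure given by a density *)

Section Density.
Context d (T : measurableType d) (R : realType).
Variables (nu : {finite_measure set T -> \bar R})
  (mu : {sigma_finite_measure set T -> \bar R}) (g : T -> R).
Hypotheses (mg : measurable_fun setT g) (g0 : forall x, (0 <= g x)%R).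
Hypothesis nuE : forall A, measurable A -> nu A = \int[mu]_(x in A) (g x)%:E.

Lemma density_dominates : nu `<< mu.
Proof.
apply/null_content_dominatesP => A mA muA; rewrite nuE //.
by apply: null_set_integral => //; apply/measurable_EFinP; exact: measurable_funTS.
Qed.

(** The formula holds for the Radon-Nikodym derivative, and g agrees with it almost everywhere
    because both have the same integral over every measurable set. *)
Lemma density_integral (F : T -> \bar R) : measurable_fun setT F ->
  (forall x, 0 <= F x) -> \int[nu]_x F x = \int[mu]_x (F x * (g x)%:E).
Proof.
move=> mF F0; have dom := density_dominates.
rewrite -(Radon_Nikodym_SigmaFinite.change_of_variables dom) //.
have mf := measurable_int _ (Radon_Nikodym_SigmaFinite.f_integrable dom).
apply: ae_eq_integral => //; [exact: emeasurable_funM| |].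
  by apply: emeasurable_funM => //; exact/measurable_EFinP.
apply: ae_eqe_mul2l; apply: integral_ae_eq => //.
- exact: Radon_Nikodym_SigmaFinite.f_integrable.
- exact/measurable_EFinP.
- by move=> A _ mA; rewrite -Radon_Nikodym_SigmaFinite.f_integral // nuE.
Qed.

End Density.

(** * Affine change of variables for the normal law on the line *)

Section Affine.
Context {R : realType}.
Notation mu := (@lebesgue_measure R).
Implicit Types (a v : R) (F : R -> \bar R).

(** By uniqueness of Lebesgue measure it suffices to compare it, on half-open intervals, with a
    times its image under x |-> a x + v. *)
Lemma integral_affine a v F : (0 < a)%R -> measurable_fun setT F ->
  (forall x, 0 <= F x) ->
  \int[mu]_x F x = a%:E * \int[mu]_x F (a * x + v)%R.
Proof.
move=> a0 mF F0; pose f (x : measurableTypeR R) : measurableTypeR R := (a * x + v)%R.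
have mf : measurable_fun setT f.
  by apply: measurable_funD => //; exact: measurable_funM.
pose k := NngNum (ltW a0).
have muE A : measurable A -> mu A = mscale k (pushforward mu f) A.
  move=> mA; apply: lebesgue_measure_unique => // _ [[x y] _ <-] /=.
  rewrite /mscale/= /pushforward.
  have -> : f @^-1` `]x, y]%classic = `]((x - v) / a)%R, ((y - v) / a)%R]%classic.
    apply/seteqP; split=> z /=; rewrite !in_itv /= ltr_pdivrMr // ler_pdivlMr //;
      by rewrite /f mulrC => /andP[? ?]; apply/andP; split; lra.
  rewrite !lebesgue_measure_itv /= !lte_fin ltr_pM2r ?invr_gt0 // ltrD2r.
  case: ifP => _; last by rewrite mule0.
  by rewrite -!EFinB -EFinM; congr EFin; field; rewrite gt_eqF.
rewrite (eq_measure_integral (mscale k (pushforward mu f))) => [|A mA _]; last exact: muE.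
by rewrite ge0_integral_mscale //= ge0_integral_pushforward.
Qed.

Lemma integral_std_gauss F : measurable_fun setT F -> (forall x, 0 <= F x) ->
  \int[normal_prob 0 1]_x F x = \int[mu]_x (F x * (normal_pdf 0 1 x)%:E).
Proof.
move=> mF F0; apply: (@density_integral _ (measurableTypeR R) R (normal_prob 0 1) mu) => //.
exact: measurable_normal_pdf.
Qed.

(** The density at x of the law of a Z + v with respect to that of Z, for Z standard normal: the
    normalizing constants of the two normal densities cancel. *)
Definition gauss_ratio1 a v (x : R) : R :=
  a^-1 * expR ((x ^+ 2 - ((x - v) / a) ^+ 2) / 2).

Lemma gauss_ratio1_ge0 a v x : (0 < a)%R -> (0 <= gauss_ratio1 a v x)%R.
Proof. by move=> a0; rewrite mulr_ge0 ?expR_ge0 // invr_ge0 ltW. Qed.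

Lemma measurable_gauss_ratio1 a v : measurable_fun setT (gauss_ratio1 a v).
Proof.
apply: measurable_funM => //; apply: measurableT_comp => //.
apply: measurable_funM => //; apply: measurable_funB => //.
by apply: measurable_funX; apply: measurable_funM => //; exact: measurable_funB.
Qed.

Lemma std_gauss_affine a v F : (0 < a)%R -> measurable_fun setT F ->
  (forall x, 0 <= F x) ->
  \int[normal_prob 0 1]_x F (a * x + v)%R =
  \int[normal_prob 0 1]_x (F x * (gauss_ratio1 a v x)%:E).
Proof.
move=> a0 mF F0.
have maff : measurable_fun [set: R] (fun x => a * x + v)%R.
  by apply: measurable_funD => //; exact: measurable_funM.
rewrite integral_std_gauss; [|exact: measurableT_comp|by []].
rewrite integral_std_gauss; last 2 first.
- by apply: emeasurable_funM => //; apply/measurable_EFinP; exact: measurable_gauss_ratio1.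
- by move=> x; rewrite mule_ge0 // lee_fin gauss_ratio1_ge0.
(* The substitution is made on the right-hand side, where its factor a cancels the a^-1 of
   [gauss_ratio1]. *)
rewrite [RHS](@integral_affine a v) //; last 2 first.
- apply: emeasurable_funM; last by apply/measurable_EFinP; exact: measurable_normal_pdf.
  by apply: emeasurable_funM => //; apply/measurable_EFinP; exact: measurable_gauss_ratio1.
- move=> x; rewrite mule_ge0 ?lee_fin ?normal_pdf_ge0 //.
  by rewrite mule_ge0 // lee_fin gauss_ratio1_ge0.
rewrite -ge0_integralZl //; last 3 first.
- apply: (@measurableT_comp _ _ _ _ _ _
    (fun x => F x * (gauss_ratio1 a v x)%:E * (normal_pdf 0 1 x)%:E) _
    (fun x => a * x + v)%R) => //.
  apply: emeasurable_funM; last by apply/measurable_EFinP; exact: measurable_normal_pdf.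
  by apply: emeasurable_funM => //; apply/measurable_EFinP; exact: measurable_gauss_ratio1.
- move=> x _; rewrite mule_ge0 ?lee_fin ?normal_pdf_ge0 //.
  by rewrite mule_ge0 // lee_fin gauss_ratio1_ge0.
- by rewrite lee_fin ltW.
apply: eq_integral => x _.
rewrite -muleA -EFinM muleCA -EFinM; congr (_ * EFin _).
rewrite !normal_pdfE ?oner_eq0 // /normal_fun /gauss_ratio1 !subr0 expr1n.
rewrite addrK (mulrC a x) mulfK ?gt_eqF // -mulrA mulVKf ?gt_eqF //.
rewrite mulrCA -expRD; congr (_ * expR _)%R.
by field.
Qed.

End Affine.

(** * Passage between tuples, which carry the sigma-algebra, and columns, which carry the algebra *)

Section TupleVectors.
Context {R : realType}.

Definition cvec m (x : m.-tuple R) : 'cV[R]_m := \col_i tnth x i.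

Definition tvec m (u : 'cV[R]_m) : m.-tuple R := [tuple u i 0%R | i < m].

Lemma cvecK m : cancel (@cvec m) (@tvec m).
Proof. by move=> x; apply: eq_from_tnth => i; rewrite tnth_mktuple mxE. Qed.

Lemma tvecK m : cancel (@tvec m) (@cvec m).
Proof. by move=> u; apply/colP => i; rewrite mxE tnth_mktuple. Qed.

Lemma mx_actE m n (A : 'M[R]_(m, n)) x : mx_act A x = tvec (A *m cvec x).
Proof.
apply: eq_from_tnth => i; rewrite !tnth_mktuple mxE.
by apply: eq_bigr => j _; rewrite mxE.
Qed.

Lemma cvec_cons p z (x : p.-tuple R) :
  cvec [tuple of z :: x] = col_mx (z%:M : 'M[R]_1) (cvec x) :> 'cV[R]_(1 + p).
Proof.
apply/colP => i; case: (split_ordP i) => j ->; rewrite ?col_mxEu ?col_mxEd !mxE.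
  by rewrite !ord1 /= mulr1n (tnth_nth 0%R).
by rewrite !(tnth_nth 0%R).
Qed.

Definition sqnorm m (u : 'cV[R]_m) : R := \sum_i (u i 0) ^+ 2.

Lemma sqnorm_ge0 m (u : 'cV[R]_m) : (0 <= sqnorm u)%R.
Proof. by apply: sumr_ge0 => i _; exact: sqr_ge0. Qed.

Lemma sqnorm_col p (z : R) (u : 'cV[R]_p) :
  sqnorm (col_mx (z%:M : 'M[R]_1) u) = (z ^+ 2 + sqnorm u)%R.
Proof.
rewrite /sqnorm big_split_ord /= big_ord1 col_mxEu mxE eqxx mulr1n.
by congr (_ + _)%R; apply: eq_bigr => i _; rewrite col_mxEd.
Qed.

Lemma measurable_tvec d (T : measurableType d) m (f : T -> 'cV[R]_m) :
  (forall i, measurable_fun setT (fun t => f t i 0%R)) ->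
  measurable_fun setT (fun t => tvec (f t)).
Proof.
move=> mf; apply/measurable_fun_tnthP => i.
rewrite (_ : _ \o _ = fun t => f t i 0%R) //.
by apply/funext => t /=; rewrite tnth_mktuple.
Qed.

Lemma measurable_cvec d (T : measurableType d) m (f : T -> m.-tuple R) i :
  measurable_fun setT f -> measurable_fun setT (fun t => cvec (f t) i 0%R).
Proof.
move=> mf; rewrite (_ : (fun _ => _) = (fun x => tnth x i) \o f).
  by apply: measurableT_comp => //; exact: measurable_tnth.
by apply/funext => t /=; rewrite mxE.
Qed.

Lemma measurable_mulmx d (T : measurableType d) m n (A : 'M[R]_(m, n))
    (f : T -> 'cV[R]_n) i :
  (forall i, measurable_fun setT (fun t => f t i 0%R)) ->
  measurable_fun setT (fun t => (A *m f t) i 0%R).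
Proof.
move=> mf; rewrite (_ : (fun _ => _) = fun t => (\sum_j A i j * f t j 0)%R).
  by apply: measurable_sum => j; exact: measurable_funM.
by apply/funext => t /=; rewrite mxE.
Qed.

Lemma measurable_addmx d (T : measurableType d) m (f g : T -> 'cV[R]_m) i :
  (forall i, measurable_fun setT (fun t => f t i 0%R)) ->
  (forall i, measurable_fun setT (fun t => g t i 0%R)) ->
  measurable_fun setT (fun t => (f t + g t)%R i 0%R).
Proof.
move=> mf mg; rewrite (_ : (fun _ => _) = fun t => (f t i 0 + g t i 0)%R).
  exact: measurable_funD.
by apply/funext => t; rewrite mxE.
Qed.

Lemma measurable_scalemx d (T : measurableType d) m (f : T -> R) (u : 'cV[R]_m) i :
  measurable_fun setT f -> measurable_fun setT (fun t => (f t *: u) i 0%R).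
Proof.
move=> mf; rewrite (_ : (fun _ => _) = fun t => (f t * u i 0)%R).
  exact: measurable_funM.
by apply/funext => t; rewrite mxE.
Qed.

Lemma measurable_sqnorm d (T : measurableType d) m (f : T -> 'cV[R]_m) :
  (forall i, measurable_fun setT (fun t => f t i 0%R)) ->
  measurable_fun setT (fun t => sqnorm (f t)).
Proof. by move=> mf; apply: measurable_sum => j; exact: measurable_funX. Qed.

End TupleVectors.

(** * Triangular affine images of the standard normal law *)

Section StdNormal.
Context {R : realType}.

Lemma std_normal_recl p (F : p.+1.-tuple R -> \bar R) :
  measurable_fun setT F -> (forall x, 0 <= F x) ->
  \int[std_normal p.+1]_x F x =
  \int[normal_prob 0 1]_z \int[std_normal p]_x F [tuple of z :: x].
Proof.
move=> mF F0 /=; rewrite ge0_integral_distribution // fubini_tonelli1 //; last first.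
  by move=> x; exact: F0.
by apply: measurableT_comp => //; exact: measurable_cons_pair.
Qed.

Lemma integral_std_normal0 (F : 0.-tuple R -> \bar R) :
  measurable_fun setT F -> \int[std_normal 0]_x F x = F [tuple].
Proof. by move=> mF /=; rewrite integral_dirac // diracT mul1e. Qed.

(* The density at [x] of the law of [A Z + v] with respect to that of [Z]. *)
Definition gauss_ratio m (A : 'M[R]_m) (v x : 'cV[R]_m) : R :=
  (\prod_i A i i)^-1 * expR ((sqnorm x - sqnorm (invmx A *m (x - v))) / 2).

Lemma gauss_ratio_gt0 m (A : 'M[R]_m) v x :
  pos_diag A -> (0 < gauss_ratio A v x)%R.
Proof. by move=> dA; rewrite mulr_gt0 ?expR_gt0 // invr_gt0 prodr_gt0. Qed.

Lemma measurable_gauss_ratio d (T : measurableType d) m (A : 'M[R]_m)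
    (v x : T -> 'cV[R]_m) :
  (forall i, measurable_fun setT (fun t => v t i 0%R)) ->
  (forall i, measurable_fun setT (fun t => x t i 0%R)) ->
  measurable_fun setT (fun t => gauss_ratio A (v t) (x t)).
Proof.
move=> mv mx; apply: measurable_funM => //; apply: measurableT_comp => //.
apply: measurable_funM => //; apply: measurable_funB => //.
  exact: measurable_sqnorm.
apply: measurable_sqnorm => i; apply: measurable_mulmx => j.
rewrite (_ : (fun _ => _) = fun t => (x t j 0 - v t j 0)%R).
  exact: measurable_funB.
by apply/funext => t; rewrite !mxE.
Qed.

(** Chain rule for densities. Solving the block triangular system gives t = (z - v0) / a first; the
    other coordinates then follow an affine law whose shift is corrected by t b. *)
Lemma gauss_ratio_block p (a : R) (b : 'cV[R]_p) (A : 'M[R]_p) v0 v z x :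
  (0 < a)%R -> A \in unitmx ->
  gauss_ratio (block_mx (a%:M : 'M[R]_1) 0 b A) (col_mx (v0%:M : 'M[R]_1) v)
    (col_mx (z%:M : 'M[R]_1) x) =
  (gauss_ratio A (((z - v0) / a) *: b + v) x * gauss_ratio1 a v0 z)%R.
Proof.
move=> a0 uA; rewrite /gauss_ratio /gauss_ratio1.
set w := invmx A *m _; set t := ((z - v0) / a)%R.
have uB : block_mx (a%:M : 'M[R]_1) 0 b A \in unitmx.
  by rewrite unitmxE det_lblock det_scalar1 unitrM -unitmxE uA unitfE gt_eqF.
have -> : invmx (block_mx (a%:M : 'M[R]_1) 0 b A) *m
    (col_mx (z%:M : 'M[R]_1) x - col_mx (v0%:M : 'M[R]_1) v) = col_mx t%:M w.
  rewrite -[RHS](mulKmx uB); congr (_ *m _).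
  rewrite mul_block_col opp_col_mx add_col_mx mul0mx addr0 mulKVmx //.
  rewrite -scalar_mxM mul_mx_scalar -raddfN -raddfD /=.
rewrite -/t [(a * t)%R]mulrC divfK ?gt_eqF //; congr col_mx.
  by rewrite opprD [RHS]addrCA addNKr.
rewrite !sqnorm_col big_split_ord /= big_ord1 block_mxEul mxE eqxx mulr1n.
rewrite (eq_bigr (fun i => A i i)) => [|i _]; last by rewrite block_mxEdr.
rewrite [RHS]mulrACA -expRD invfM [(a^-1 * _)%R]mulrC; congr (_ * expR _)%R.
by field.
Qed.

(** Induction on m: the first output coordinate depends on the first input only, and at fixed first
    input z the others undergo a triangular affine map shifted by z b. *)
Lemma std_normal_affine m (A : 'M[R]_m) (v : 'cV[R]_m) (F : m.-tuple R -> \bar R) :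
  is_trig_mx A -> pos_diag A -> measurable_fun setT F -> (forall x, 0 <= F x) ->
  \int[std_normal m]_x F (tvec (A *m cvec x + v)) =
  \int[std_normal m]_x (F x * (gauss_ratio A v (cvec x))%:E).
Proof.
elim: m A v F => [|p IH] A v F tA pA mF F0.
  rewrite !integral_std_normal0; last 2 first.
  - apply: emeasurable_funM => //; apply/measurable_EFinP.
    by apply: (@measurable_gauss_ratio _ _ _ A (fun=> v) (@cvec R 0)) => -[].
  - by apply: (measurableT_comp mF); apply: measurable_tvec => -[].
  rewrite (_ : tvec _ = [tuple]); last by apply: eq_from_tnth => -[].
  by rewrite /gauss_ratio /sqnorm !big_ord0 subrr mul0r expR0 invr1 mulr1 mule1.
suff H (B : 'M[R]_(1 + p)) (w : 'cV[R]_(1 + p)) : is_trig_mx B -> pos_diag B ->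
  \int[std_normal p.+1]_x F (tvec (B *m cvec x + w)) =
  \int[std_normal p.+1]_x (F x * (gauss_ratio B w (cvec x))%:E) by exact: H.
move=> {}tA {}pA; set a := (B 0 0)%R; set b := dlsubmx B; set B' := drsubmx B.
have Eul : ulsubmx B = a%:M.
  by apply/matrixP => i j; rewrite !ord1 !mxE /= mulr1n; congr (B _ _); apply/val_inj.
have EB : B = block_mx a%:M 0 b B' by rewrite -Eul -(ursubmx_trig _ tA) // submxK.
set w0 := (w 0 0)%R; set w' := dsubmx w.
have Ew : w = col_mx w0%:M w'.
  rewrite -[w in LHS]vsubmxK; congr col_mx; apply/matrixP => i j.
  by rewrite !ord1 !mxE /= mulr1n; congr (w _ _); apply/val_inj.
have a0 : (0 < a)%R by exact: pA.
have tB' : is_trig_mx B' by exact: drsubmx_trig.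
have pB' : pos_diag B' by move=> i; rewrite !mxE.
have uB' := trig_pos_unitmx tB' pB'.
have mcons d (T : measurableType d) (f : T -> R) (g : T -> p.-tuple R) :
    measurable_fun setT f -> measurable_fun setT g ->
    measurable_fun setT (fun t => F [tuple of f t :: g t]).
  by move=> mf mg; apply: (measurableT_comp mF); exact: measurable_cons.
rewrite !std_normal_recl; last 4 first.
- apply: emeasurable_funM => //; apply/measurable_EFinP.
  apply: (@measurable_gauss_ratio _ _ _ B (fun=> w) (@cvec R p.+1)) => i //.
  exact: measurable_cvec.
- by move=> x; rewrite mule_ge0 // lee_fin ltW // gauss_ratio_gt0.
- apply: (measurableT_comp mF); apply: measurable_tvec => i.
  apply: measurable_addmx => // j; apply: measurable_mulmx => l.
  exact: measurable_cvec.
- by move=> x; exact: F0.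
have Etv z (x : p.-tuple R) : tvec (B *m cvec [tuple of z :: x] + w) =
    [tuple of (a * z + w0)%R :: tvec (B' *m cvec x + (z *: b + w'))].
  rewrite cvec_cons -[RHS]cvecK cvec_cons tvecK {1}EB {1}Ew mul_block_col mul0mx addr0.
  rewrite add_col_mx -scalar_mxM mul_mx_scalar -raddfD /=.
  by rewrite addrA [(B' *m _ + _)%R]addrC.
under eq_integral => z _ do under eq_integral => x _ do rewrite Etv.
(* The first argument of G is the transformed first coordinate; (z - w0) / a recovers the original
   one, so that at a z + w0 the shift is z b + w'. *)
pose G z (x : p.-tuple R) :=
  F [tuple of z :: x] * (gauss_ratio B' (((z - w0) / a) *: b + w') (cvec x))%:E.
have G0 z x : 0 <= G z x by rewrite mule_ge0 // lee_fin ltW // gauss_ratio_gt0.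
have mG d (T : measurableType d) (f : T -> R) (g : T -> p.-tuple R) :
    measurable_fun setT f -> measurable_fun setT g ->
    measurable_fun setT (fun t => G (f t) (g t)).
  move=> mf mg; apply: emeasurable_funM; first exact: mcons.
  apply/measurable_EFinP; apply: (@measurable_gauss_ratio _ _ _ B'
    (fun t => ((f t - w0) / a) *: b + w')%R (fun t => cvec (g t))) => i.
    apply: measurable_addmx => // j; apply: measurable_scalemx.
    by apply: measurable_funM => //; exact: measurable_funB.
  exact: measurable_cvec.
transitivity (\int[normal_prob 0 1]_z \int[std_normal p]_x G (a * z + w0)%R x).
  apply: eq_integral => z _; pose Fz (x : p.-tuple R) := F [tuple of (a * z + w0)%R :: x].
  have mFz : measurable_fun setT Fz by exact: mcons.
  apply: (eq_trans (IH B' (z *: b + w')%R Fz tB' pB' mFz (fun x => F0 _))).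
  apply: eq_integral => x _; rewrite /G (_ : (_ - w0) / a = z)%R //.
  by rewrite addrK mulrC mulKf // gt_eqF.
have mH1 : measurable_fun setT
    (fun zx : measurableTypeR R * p.-tuple R => G (a * zx.1 + w0)%R zx.2).
  by apply: mG => //; apply: measurable_funD => //; exact: measurable_funM.
have mH2 : measurable_fun setT
    (fun zx : measurableTypeR R * p.-tuple R => G zx.1 zx.2 * (gauss_ratio1 a w0 zx.1)%:E).
  apply: emeasurable_funM; first exact: mG.
  by apply/measurable_EFinP/measurableT_comp => //; exact: measurable_gauss_ratio1.
(* The integrals are exchanged so that, at fixed x, the one-dimensional change of variables applies
   to z; they are exchanged back afterwards. *)
apply: (eq_trans (fubini_tonelli (m1 := normal_prob 0 1) (m2 := std_normal p)
  _ mH1 (fun zx => G0 _ _))).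
transitivity (\int[std_normal p]_x \int[normal_prob 0 1]_z
    (G z x * (gauss_ratio1 a w0 z)%:E)).
  apply: eq_integral => x _; rewrite (@std_gauss_affine _ a w0 (G ^~ x)) //.
  exact: mG.
apply: (eq_trans (esym (fubini_tonelli (m1 := normal_prob 0 1) (m2 := std_normal p)
  _ mH2 _))) => [zx|].
  by rewrite mule_ge0 // lee_fin gauss_ratio1_ge0.
apply: eq_integral => z _; apply: eq_integral => x _; rewrite /G -muleA -EFinM.
by rewrite cvec_cons EB Ew gauss_ratio_block.
Qed.

End StdNormal.

Lemma integral_prob_cst d (T : measurableType d) (R : realType)
    (P : probability T R) (c : R) : \int[P]_x c%:E = c%:E.
Proof.
by have := integral_cst P measurableT c%:E; rewrite [X in _ * X]probability_setT mule1.
Qed.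

(** * Mean and variance of the standard normal law *)

Section Moments.
Context {R : realType}.
Notation N01 := (normal_prob (0 : R) 1).

Lemma integral_gauss_ratio1 (a v : R) : (0 < a)%R ->
  \int[N01]_x (gauss_ratio1 a v x)%:E = 1.
Proof.
move=> a0; have := @std_gauss_affine R a v (cst 1) a0 (measurable_cst _) (fun=> lee01).
rewrite /= integral_prob_cst => ->.
by apply: eq_integral => x _; rewrite /= mul1e.
Qed.

Lemma ln_gauss_ratio1 (a v x : R) : (0 < a)%R ->
  ln (gauss_ratio1 a v x) = (- ln a + (x ^+ 2 - ((x - v) / a) ^+ 2) / 2)%R.
Proof.
by move=> a0; rewrite lnM ?posrE ?invr_gt0 ?expR_gt0 // lnV ?posrE // expRK.
Qed.

(** The density of 2 Z with respect to Z integrates to 1 and equals exp (3 x^2 / 8) / 2. By e^t >= 1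
    + t it is at least 3 x^2 / 16, hence the factor 16 / 3. *)
Lemma std_gauss_integrable_sqr : N01.-integrable setT (EFin \o (fun x => x ^+ 2)%R).
Proof.
apply/integrableP; split; first by apply/measurable_EFinP; exact: measurable_funX.
apply: (@le_lt_trans _ _ (\int[N01]_x ((16 / 3)%:E * (gauss_ratio1 2 0 x)%:E))).
  apply: ge0_le_integral => //.
  - apply: measurableT_comp => //; apply/measurable_EFinP; exact: measurable_funX.
  - apply: emeasurable_funM => //; apply/measurable_EFinP; exact: measurable_gauss_ratio1.
  - move=> x _ /=; rewrite ger0_norm ?sqr_ge0 // -EFinM lee_fin /gauss_ratio1 subr0.
    have := @expR_ge1Dx R ((x ^+ 2 - (x / 2) ^+ 2) / 2); set e := expR _ => he.
    have -> : (16 / 3 * (2^-1 * e) = 8 / 3 * e)%R by field.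
    have : ((x / 2) ^+ 2 = x ^+ 2 / 4)%R by field.
    by move: he; lra.
rewrite ge0_integralZl //.
- by rewrite integral_gauss_ratio1 // mule1 ltry.
- by apply/measurable_EFinP; exact: measurable_gauss_ratio1.
- by move=> x _; rewrite lee_fin gauss_ratio1_ge0.
Qed.

Lemma std_gauss_integrable_id : N01.-integrable setT (EFin \o id).
Proof.
apply: (@le_integrable _ _ _ N01 setT measurableT _
    (fun x => 1 + ((x ^+ 2)%R)%:E)) => //.
- by apply/measurable_EFinP; exact: measurable_id.
- move=> y _ /=; rewrite lee_fin [leRHS]ger0_norm ?addr_ge0 ?sqr_ge0 //.
  exact: normr_le_1Dsqr.
- apply: integrableD => //; last exact: std_gauss_integrable_sqr.
  by apply: finite_measure_integrable_cst.
Qed.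

(** The two moments are not computed from the normal density. They are forced by inequalities which
    express that each [gauss_ratio1 a v] has integral 1. *)
Let m1 := fine (\int[N01]_x x%:E).
Let m2 := fine (\int[N01]_x (x ^+ 2)%:E).

Let integral_affine_sqr (c0 c1 c2 : R) :
  N01.-integrable setT (fun x => (c0 + c1 * x + c2 * x ^+ 2)%:E) /\
  \int[N01]_x (c0 + c1 * x + c2 * x ^+ 2)%:E = (c0 + c1 * m1 + c2 * m2)%:E.
Proof.
have i1 : N01.-integrable setT (fun x => c1%:E * x%:E).
  by apply: integrableZl => //; exact: std_gauss_integrable_id.
have i2 : N01.-integrable setT (fun x => c2%:E * (x ^+ 2)%:E).
  by apply: integrableZl => //; exact: std_gauss_integrable_sqr.
have i0 : N01.-integrable setT (cst c0%:E) by exact: finite_measure_integrable_cst.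
have i01 : N01.-integrable setT (fun x => c0%:E + c1%:E * x%:E) by exact: integrableD.
split; first by under eq_fun do rewrite !EFinD !EFinM; exact: integrableD.
under eq_integral do rewrite !EFinD !EFinM.
rewrite integralD // integralD // integralZl //; last exact: std_gauss_integrable_id.
rewrite integralZl //; last exact: std_gauss_integrable_sqr.
rewrite integral_prob_cst !EFinD !EFinM /m1 /m2 !fineK //.
- by apply: integrable_fin_num => //; exact: std_gauss_integrable_sqr.
- by apply: integrable_fin_num => //; exact: std_gauss_integrable_id.
Qed.

(* Jensen's inequality for the probability density [gauss_ratio1 a v]. *)
Let moments_ineq (a v : R) : (0 < a)%R ->
  (- ln a + (m2 - (m2 - 2 * v * m1 + v ^+ 2) / a ^+ 2) / 2 <= 0)%R.
Proof.
move=> a0; have [int_c c] := integral_affine_sqr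
  (1 - ln a - v ^+ 2 / a ^+ 2 / 2) (v / a ^+ 2) ((1 - (a ^+ 2)^-1) / 2).
have int_g : N01.-integrable setT (fun x => (gauss_ratio1 a v x)%:E).
  apply/integrableP; split.
    by apply/measurable_EFinP; exact: measurable_gauss_ratio1.
  under eq_integral do rewrite /= ger0_norm ?gauss_ratio1_ge0 //.
  by rewrite integral_gauss_ratio1 // ltry.
have := le_integral measurableT int_c int_g; rewrite c integral_gauss_ratio1 // lee_fin.
have a20 : (a ^+ 2 != 0)%R by rewrite expf_neq0 // gt_eqF.
have an0 : (a != 0)%R by rewrite gt_eqF.
move=> h; suff : (1 - ln a - v ^+ 2 / a ^+ 2 / 2 + v / a ^+ 2 * m1 +
     (1 - (a ^+ 2)^-1) / 2 * m2 <= 1)%R.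
  suff -> : (1 - ln a - v ^+ 2 / a ^+ 2 / 2 + v / a ^+ 2 * m1 +
     (1 - (a ^+ 2)^-1) / 2 * m2 = 
     1 + (- ln a + (m2 - (m2 - 2 * v * m1 + v ^+ 2) / a ^+ 2) / 2))%R by lra.
  by field.
apply: h => x _; rewrite lee_fin.
have := @expR_ge1Dx R (ln (gauss_ratio1 a v x)).
have g0 : (0 < gauss_ratio1 a v x)%R.
  by rewrite mulr_gt0 ?invr_gt0 ?expR_gt0.
rewrite lnK ?posrE // ln_gauss_ratio1 //; apply: le_trans.
by rewrite le_eqVlt; apply/orP; left; apply/eqP; field.
Qed.

(** At a = 1 and v = m1 the left-hand side of [moments_ineq] is m1^2 / 2. *)
Let m1_eq0 : m1 = 0%R.
Proof.
have := @moments_ineq 1 m1 ltr01; rewrite ln1 expr1n divr1 => h.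
by apply/eqP; rewrite -sqrf_eq0 eq_le sqr_ge0 andbT; lra.
Qed.

(** With v = 0, a^2 = b and ln b <= b - 1, the moment inequality becomes (b - 1) (m2 - b) <= 0. The
    midpoint b of 1 and m2 makes both factors equal to (m2 - 1) / 2. *)
Let m2_eq1 : m2 = 1%R.
Proof.
have m20 : (0 <= m2)%R.
  by rewrite fine_ge0 // integral_ge0 // => x _; rewrite lee_fin sqr_ge0.
pose b := ((1 + m2) / 2)%R; have b0 : (0 < b)%R by rewrite /b; lra.
have := @moments_ineq (Num.sqrt b) 0; rewrite sqrtr_gt0 => /(_ b0).
rewrite m1_eq0 mulr0 subr0 expr0n /= addr0 sqr_sqrtr; last exact: ltW.
have : (ln (Num.sqrt b) <= (b - 1) / 2)%R.
  have -> : ln (Num.sqrt b) = (ln b / 2)%R.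
    by rewrite -{2}[b](sqr_sqrtr (ltW b0)) lnXn ?sqrtr_gt0 // mulr2n; lra.
  have := @le_ln1Dx R (b - 1); rewrite addrCA subrr addr0; lra.
move=> h1 h2; have : (m2 - m2 / b <= b - 1)%R by lra.
rewrite -(ler_pM2r b0) mulrBl divfK ?gt_eqF // => h3.
have : (((m2 - 1) / 2) ^+ 2 <= 0)%R.
  by move: h3; rewrite /b; nra.
move=> h4; have /eqP : (((m2 - 1) / 2) ^+ 2 == 0)%R by rewrite eq_le h4 sqr_ge0.
by move=> /eqP; rewrite sqrf_eq0 => /eqP; lra.
Qed.

Lemma std_gauss_affine_sqr (c w : R) :
  \int[N01]_x ((c + w * x) ^+ 2)%:E = (c ^+ 2 + w ^+ 2)%:E.
Proof.
have [_] := integral_affine_sqr (c ^+ 2) (2 * c * w) (w ^+ 2).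
rewrite m1_eq0 m2_eq1 mulr0 addr0 mulr1 => <-.
by apply: eq_integral => x _; congr EFin; ring.
Qed.

End Moments.

(** * Second moments of linear images of the standard normal law *)

Section StdNormalMoments.
Context {R : realType}.

(** The constant c carries the induction: at fixed first coordinate z it becomes c + w0 z. *)
Lemma std_normal_affine_sqr m (w : 'cV[R]_m) (c : R) :
  \int[std_normal m]_x ((c + (w^T *m cvec x) 0 0) ^+ 2)%:E = (c ^+ 2 + sqnorm w)%:E.
Proof.
have mF m' (w' : 'cV[R]_m') c' : measurable_fun setT
    (fun x : m'.-tuple R => ((c' + (w'^T *m cvec x) 0 0) ^+ 2)%:E).
  apply/measurable_EFinP; apply: measurable_funX; apply: measurable_funD => //.
  by apply: measurable_mulmx => i; exact: measurable_cvec.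
elim: m w c => [|p IH] w c.
  rewrite integral_std_normal0 // mxE /sqnorm !big_ord0.
  by rewrite !addr0.
rewrite std_normal_recl //; last by move=> x; rewrite lee_fin sqr_ge0.
pose w0 := (w 0 0)%R; pose w' : 'cV[R]_p := \col_i w (lift ord0 i) 0%R.
have Ew : sqnorm w = (w0 ^+ 2 + sqnorm w')%R.
  by rewrite /sqnorm big_ord_recl; congr (_ + _)%R; apply: eq_bigr => i _; rewrite mxE.
transitivity (\int[normal_prob 0 1]_z \int[std_normal p]_x
    ((c + w0 * z + (w'^T *m cvec x) 0 0) ^+ 2)%:E).
  apply: eq_integral => z _; apply: eq_integral => x _; congr ((_ ^+ 2)%:E).
  rewrite !mxE big_ord_recl !mxE -addrA; congr (_ + (_ + _))%R.
  by apply: eq_bigr => i _; rewrite !mxE tnthS.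
under eq_integral do rewrite IH.
have : \int[normal_prob 0 1]_x ((c + w0 * x) ^+ 2 + sqnorm w')%:E =
  (c ^+ 2 + w0 ^+ 2)%:E + (sqnorm w')%:E.
  under eq_integral do rewrite EFinD.
  rewrite ge0_integralD //.
  - by rewrite std_gauss_affine_sqr integral_prob_cst.
  - by move=> x _; rewrite lee_fin sqr_ge0.
  - have m : measurable_fun [set: R] (fun x => (c + w0 * x) ^+ 2)%R.
      by apply: measurable_funX; apply: measurable_funD => //; exact: measurable_funM.
    exact/measurable_EFinP.
  - by move=> x _; rewrite lee_fin sumr_ge0 // => i _; rewrite sqr_ge0.
by move=> ->; rewrite -EFinD Ew addrA.
Qed.

Definition frob2 m n (A : 'M[R]_(m, n)) : R := \sum_i \sum_j (A i j) ^+ 2.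

Lemma std_normal_sqnorm m n (A : 'M[R]_(m, n)) :
  \int[std_normal n]_x (sqnorm (A *m cvec x))%:E = (frob2 A)%:E.
Proof.
under eq_integral do rewrite /sqnorm -sumEFin.
rewrite ge0_integral_sum //.
- rewrite /frob2 -sumEFin; apply: eq_bigr => i _.
  have := std_normal_affine_sqr (row i A)^T 0; rewrite expr0n /= add0r.
  have -> : sqnorm (row i A)^T = (\sum_j A i j ^+ 2)%R.
    by apply: eq_bigr => j _; rewrite !mxE.
  move=> <-; apply: eq_integral => x _; rewrite add0r trmxK; congr ((_ ^+ 2)%:E).
  by rewrite -row_mul [RHS]mxE.
- move=> i; apply/measurable_EFinP; apply: measurable_funX.
  by apply: measurable_mulmx => j; exact: measurable_cvec.
- by move=> i x _; rewrite lee_fin sqr_ge0.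
Qed.

End StdNormalMoments.

(** * Divergence through explicit densities, and data processing *)

Section Divergence.
Context {R : realType}.

Lemma measurable_lne_EFin d (T : measurableType d) (f : T -> R) :
  measurable_fun setT f -> measurable_fun setT (fun x => lne (f x)%:E).
Proof.
move=> mf; apply: measurable_fun_ifT => //.
- by apply: measurable_fun_ler.
- by apply/measurable_EFinP/measurableT_comp => //; exact: measurable_ln.
Qed.

Section Density.
Context d (T : measurableType d) (P Q : probability T R) (g : T -> R).
Hypotheses (mg : measurable_fun setT g) (g0 : forall x, (0 <= g x)%R).
Hypothesis PE : forall A, measurable A -> P A = \int[Q]_(x in A) (g x)%:E.

(** Any explicit density may replace the Radon-Nikodym derivative: the two agree outside a Q-null
    set, which is also P-null by domination. *)
Lemma KL_density : KL P Q = \int[P]_x lne (g x)%:E.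
Proof.
have dom : P `<< Q by exact: density_dominates PE.
rewrite /KL asboolT //.
set f := Radon_Nikodym _ _.
have dom' : charge_of_finite_measure P `<< Q by exact: dom.
have fE x : f x = (fine (f x))%:E by rewrite fineK // Radon_Nikodym_fin_num.
have mf : measurable_fun setT f.
  by apply: (@measurable_int _ _ _ Q); exact: Radon_Nikodym_integrable.
apply: ae_eq_integral => //.
- rewrite (_ : (fun _ => _) = fun x => lne (fine (f x))%:E); last first.
    by apply/funext => x; rewrite -fE.
  by apply: measurable_lne_EFin; exact: measurableT_comp.
- exact: measurable_lne_EFin.
- apply: (null_dominates_ae_eq measurableT dom).
  apply: (@filterS _ _ _ (fun x => setT x -> f x = (g x)%:E)) => [x h _|].
    by rewrite h.
  apply: integral_ae_eq => //; [exact: Radon_Nikodym_integrable|exact/measurable_EFinP|].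
  by move=> A _ mA; rewrite -Radon_Nikodym_integral // -PE.
Qed.

Lemma density_null : P [set x | g x <= 0]%R = 0.
Proof.
have mN : measurable [set x | g x <= 0]%R.
  by rewrite -[X in measurable X]setTI; exact: measurable_fun_ler.
rewrite PE // integral0_eq // => x /= gx.
by apply/eqP; rewrite eqe eq_le gx g0.
Qed.

End Density.

Lemma density_exists d (T : measurableType d) (P Q : probability T R) : P `<< Q ->
  exists g : T -> R, [/\ measurable_fun setT g, forall x, (0 <= g x)%R &
    forall A, measurable A -> P A = \int[Q]_(x in A) (g x)%:E].
Proof.
move=> dom; pose f := Radon_Nikodym_SigmaFinite.f P Q.
have fE x : (fine (f x))%:E = f x.
  by rewrite fineK // Radon_Nikodym_SigmaFinite.f_fin_num.
exists (fine \o f); split=> [|x|A mA].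
- apply: measurableT_comp => //.
  by apply: (@measurable_int _ _ _ Q); exact: Radon_Nikodym_SigmaFinite.f_integrable.
- by rewrite fine_ge0 // Radon_Nikodym_SigmaFinite.f_ge0.
- under eq_integral do rewrite /= fE.
  exact: Radon_Nikodym_SigmaFinite.f_integral.
Qed.

(** Positive and negative parts are compared separately. The integral of g may be +oo, as that of a
    log-density is when the divergence is infinite. *)
Lemma le_integral_integrable d (T : measurableType d)
    (mu : {measure set T -> \bar R}) (f g : T -> \bar R) :
  mu.-integrable setT f -> measurable_fun setT g -> (forall x, f x <= g x) ->
  \int[mu]_x f x <= \int[mu]_x g x.
Proof.
move=> /integrableP[mf _] mg fg.
have {}fg : {in setT, forall x, f x <= g x} by move=> x _; exact: fg.
rewrite integralE [leRHS]integralE leeB //.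
- apply: ge0_le_integral => //; [exact: measurable_funepos..|].
  by move=> x /mem_set; exact: funepos_le.
- apply: ge0_le_integral => //; [exact: measurable_funeneg..|].
  by move=> x /mem_set; exact: funeneg_le.
Qed.

(* Says that [P'] is the law of [pi] under [P].  Nonnegative integrands are used
   because the laws at hand are computed by Tonelli's theorem. *)
Definition image_law d d' (T : measurableType d) (T' : measurableType d')
    (pi : T -> T') (P : probability T R) (P' : probability T' R) : Prop :=
  forall F : T' -> \bar R, measurable_fun setT F -> (forall y, 0 <= F y) ->
  \int[P']_y F y = \int[P]_x F (pi x).

Section ImageLaw.
Context d d' (T : measurableType d) (T' : measurableType d').
Context (pi : T -> T') (P : probability T R) (P' : probability T' R).
Hypotheses (mpi : measurable_fun setT pi) (PP' : image_law pi P P').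

Lemma image_law_integral (F : T' -> \bar R) : measurable_fun setT F ->
  \int[P']_y F y = \int[P]_x F (pi x).
Proof.
move=> mF; rewrite integralE [RHS]integralE !PP' //; last 2 first.
- exact: measurable_funeneg.
- exact: measurable_funepos.
by congr (_ - _); apply: eq_integral => x _; rewrite ?funeposE ?funenegE.
Qed.

Lemma image_law_integrable (F : T' -> \bar R) : measurable_fun setT F ->
  P'.-integrable setT F <-> P.-integrable setT (fun x => F (pi x)).
Proof.
move=> mF; have mFpi : measurable_fun setT (F \o pi) by exact: measurableT_comp.
have E : \int[P']_y `|F y| = \int[P]_x `|F (pi x)|.
  by rewrite -(PP' (F := fun y => `|F y|)) //; exact: measurableT_comp.
by split=> /integrableP[_ iF]; apply/integrableP; split=> //; rewrite ?E // -E.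
Qed.

Lemma image_law_set B : measurable B -> P' B = P (pi @^-1` B).
Proof.
move=> mB; have mB' : measurable (pi @^-1` B).
  by rewrite -[X in measurable X]setTI; exact: mpi.
have -> : P' B = \int[P']_y (\1_B y)%:E by rewrite integral_indic // setIT.
have -> : P (pi @^-1` B) = \int[P]_x (\1_(pi @^-1` B) x)%:E.
  by rewrite integral_indic // setIT.
by rewrite PP' //; apply/measurable_EFinP; exact: measurable_indic.
Qed.

End ImageLaw.

Lemma image_law_dominates d d' (T : measurableType d) (T' : measurableType d')
    (pi : T -> T') (P Q : probability T R) (P' Q' : probability T' R) :
  measurable_fun setT pi -> image_law pi P P' -> image_law pi Q Q' ->
  P `<< Q -> P' `<< Q'.
Proof.
move=> mpi HP HQ /null_content_dominatesP dom.
apply/null_content_dominatesP => A mA.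
move=> QA; rewrite (image_law_set mpi HP) //; apply: dom.
  by rewrite -[X in measurable X]setTI; exact: mpi.
by apply: eq_trans QA; apply: esym; exact: image_law_set.
Qed.

Section DataProcessing.
Context d d' (T : measurableType d) (T' : measurableType d').
Context (pi : T -> T') (P Q : probability T R) (P' Q' : probability T' R).
Hypotheses (mpi : measurable_fun setT pi).
Hypotheses (HP : image_law pi P P') (HQ : image_law pi Q Q').
Variable g : T' -> R.
Hypotheses (mg : measurable_fun setT g) (g0 : forall y, (0 < g y)%R).
Hypothesis PE : forall A, measurable A -> P' A = \int[Q']_(y in A) (g y)%:E.
Hypothesis ig : P'.-integrable setT (fun y => (ln (g y))%:E).

(* With f = dP/dQ and h = g o pi, the bound ln (f / h) >= 1 - h / f is integrated
   against P, and the integral of h / f is at most that of h against Q, i.e. 1. *)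
Lemma KL_data_processing : \int[P']_y (ln (g y))%:E <= KL P Q.
Proof.
have [dom|ndom] := pselect (P `<< Q); last by rewrite /KL asboolF // leey.
have [f [mf f0 fE]] := density_exists dom.
rewrite (KL_density mf fE) (image_law_integral HP); last first.
  by apply/measurable_EFinP/measurableT_comp => //; exact: measurable_ln.
pose h x := g (pi x); pose k x := (if f x <= 0 then 0 else expR (ln (h x) - ln (f x)))%R.
have mh : measurable_fun setT h by exact: measurableT_comp.
have k0 x : (0 <= k x)%R.
  by rewrite /k; case: ifP => // _; exact: expR_ge0.
have mk : measurable_fun setT k.
  apply: measurable_fun_ifT => //; first exact: measurable_fun_ler.
  apply: measurableT_comp => //.
  by apply: measurable_funB; apply: measurableT_comp => //; exact: measurable_ln.
have ik1 : \int[P]_x (k x)%:E <= 1.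
  rewrite (density_integral mf fE) //; last exact/measurable_EFinP.
  have -> : 1 = \int[Q]_x (h x)%:E.
    rewrite -(HQ (F := fun y => (g y)%:E)) -?PE ?probability_setT //.
      exact/measurable_EFinP.
    by move=> y; rewrite lee_fin ltW.
  apply: ge0_le_integral => //.
  - by move=> x _; rewrite mule_ge0 ?lee_fin.
  - by apply: emeasurable_funM; exact/measurable_EFinP.
  - exact/measurable_EFinP.
  - move=> x _; rewrite -EFinM lee_fin /k; case: ifPn => [_|].
      by rewrite mul0r ltW // g0.
    by rewrite -ltNge => fx; rewrite expRB !lnK ?posrE ?g0 // divfK // gt_eqF.
have ik : P.-integrable setT (EFin \o k).
  apply/integrableP; split; first exact/measurable_EFinP.
  under eq_integral do rewrite /= ger0_norm //.
  exact: le_lt_trans ik1 (ltry _).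
have il : P.-integrable setT (fun x => (ln (h x))%:E).
  apply/(image_law_integrable mpi HP (F := fun y => (ln (g y))%:E)) => //.
  by case/integrableP: ig.
pose G x := ((ln (h x))%:E + 1) - (k x)%:E.
have i1 : P.-integrable setT (cst 1%:E) by exact: finite_measure_integrable_cst.
have iG : P.-integrable setT G by apply: integrableB => //; exact: integrableD.
(* On the P-null set where f vanishes the log-density is -oo; u takes the value of G there, so that
   G <= u holds at every point. *)
pose u x := if (f x <= 0)%R then G x else (ln (f x))%:E.
have -> : \int[P]_x lne (f x)%:E = \int[P]_x u x.
  apply: ae_eq_integral => //; first exact: measurable_lne_EFin.
    apply: measurable_fun_ifT => //; first exact: measurable_fun_ler.
      by case/integrableP: iG.
    by apply/measurable_EFinP/measurableT_comp => //; exact: measurable_ln.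
  exists [set x | f x <= 0]%R; split.
  - by rewrite -[X in measurable X]setTI; exact: measurable_fun_ler.
  - exact: density_null fE.
  - move=> x /= /not_implyP[_]; rewrite /u /lne; case: ifPn => //.
apply: (@le_trans _ _ (\int[P]_x G x)).
  rewrite integralB //; last exact: integrableD.
  rewrite integralD // integral_prob_cst -addeA leeDl //.
  by rewrite subre_ge0.
apply: le_integral_integrable => //.
  apply: measurable_fun_ifT => //; first exact: measurable_fun_ler.
    by case/integrableP: iG.
  by apply/measurable_EFinP/measurableT_comp => //; exact: measurable_ln.
move=> x; rewrite /u; case: ifPn => //; rewrite -ltNge => fx.
rewrite /G /k (lt_geF fx) -!EFinD lee_fin.
have := @expR_ge1Dx R (ln (h x) - ln (f x)); lra.
Qed.

End DataProcessing.

End Divergence.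

(** * Density and divergence of normal laws *)

Section NormalLaws.
Context {R : realType}.

Lemma measurable_act m n (A : 'M[R]_(m, n)) :
  measurable_fun setT (fun x : n.-tuple R => tvec (A *m cvec x)).
Proof.
apply: measurable_tvec => i; apply: measurable_mulmx => j; exact: measurable_cvec.
Qed.

Lemma normal_law_integral m (S : 'M[R]_m) (F : m.-tuple R -> \bar R) :
  measurable_fun setT F -> (forall x, 0 <= F x) ->
  \int[normal_law S]_x F x = \int[std_normal m]_x F (tvec (chol S *m cvec x)).
Proof.
move=> mF F0; rewrite ge0_integral_distribution //.
by apply: eq_integral => x _ /=; rewrite mx_actE.
Qed.

Lemma normal_law_integral_fun m (S : 'M[R]_m) (F : m.-tuple R -> \bar R) :
  measurable_fun setT F ->
  \int[normal_law S]_x F x = \int[std_normal m]_x F (tvec (chol S *m cvec x)).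
Proof.
move=> mF; apply: image_law_integral => // G mG G0; exact: normal_law_integral.
Qed.

(* The density of N(0, S1) with respect to N(0, S2). *)
Definition gauss_dens m (S1 S2 : 'M[R]_m) (x : m.-tuple R) : R :=
  gauss_ratio (invmx (chol S2) *m chol S1) 0 (invmx (chol S2) *m cvec x).

Lemma measurable_gauss_dens m (S1 S2 : 'M[R]_m) :
  measurable_fun setT (gauss_dens S1 S2).
Proof.
apply: (@measurable_gauss_ratio _ _ _ _ _ (fun=> 0%R)
  (fun x => invmx (chol S2) *m cvec x)) => // i.
apply: measurable_mulmx => j; exact: measurable_cvec.
Qed.

Section TwoLaws.
Variables (m : nat) (S1 S2 : 'M[R]_m).
Hypotheses (p1 : posdef_mx S1) (p2 : posdef_mx S2).
Local Notation L1 := (chol S1).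
Local Notation L2 := (chol S2).
Local Notation A := (invmx L2 *m L1).

Lemma trig_chol (S : 'M[R]_m) : is_trig_mx (chol S).
Proof. by have [] := chol_chol_form S. Qed.

Lemma chol_unit (S : 'M[R]_m) : posdef_mx S -> chol S \in unitmx.
Proof. by move=> p; rewrite trig_pos_unitmx ?trig_chol //; exact: posdef_chol. Qed.

Lemma transfer_trig : is_trig_mx A.
Proof. by rewrite trig_mulmx ?trig_invmx ?trig_chol ?chol_unit. Qed.

Lemma transfer_pos : pos_diag A.
Proof.
move=> i; rewrite trig_mulmx_diag ?trig_invmx ?trig_invmx_diag ?trig_chol ?chol_unit //.
by rewrite mulr_gt0 ?invr_gt0 ?posdef_chol.
Qed.

Lemma gauss_dens_gt0 x : (0 < gauss_dens S1 S2 x)%R.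
Proof. exact: gauss_ratio_gt0 transfer_pos. Qed.

(** In the coordinates L2^-1 x the second law is the standard normal one and the first is the law of
    A Z with A triangular, so [std_normal_affine] applies to F composed with L2. *)
Lemma gauss_dens_integral (F : m.-tuple R -> \bar R) :
  measurable_fun setT F -> (forall x, 0 <= F x) ->
  \int[normal_law S1]_x F x =
  \int[normal_law S2]_x (F x * (gauss_dens S1 S2 x)%:E).
Proof.
move=> mF F0; rewrite !normal_law_integral //; last 2 first.
- by apply: emeasurable_funM => //; apply/measurable_EFinP; exact: measurable_gauss_dens.
- by move=> x; rewrite mule_ge0 // lee_fin ltW // gauss_dens_gt0.
pose G x := F (tvec (L2 *m cvec x)).
have := @std_normal_affine R m A 0 G transfer_trig transfer_pos
  (measurableT_comp mF (@measurable_act _ _ L2)) (fun=> F0 _).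
rewrite (eq_integral (fun x => F (tvec (L1 *m cvec x)))) => [->|x _].
  by apply: eq_integral => x _; rewrite /gauss_dens tvecK mulKmx // chol_unit.
by rewrite /G addr0 tvecK mulmxA mulKVmx // chol_unit.
Qed.

Lemma gauss_dens_set B : measurable B ->
  normal_law S1 B = \int[normal_law S2]_(x in B) (gauss_dens S1 S2 x)%:E.
Proof.
move=> mB.
have -> : normal_law S1 B = \int[normal_law S1]_x (\1_B x)%:E.
  by rewrite integral_indic // setIT.
rewrite gauss_dens_integral //; last first.
  by apply/measurable_EFinP; exact: measurable_indic.
rewrite [RHS]integral_mkcond; apply: eq_integral => x _.
by rewrite epatch_indic muleC.
Qed.

(** At B = L2^-1 L1 this is the classical formula: the squared Frobenius norm is tr (S2^-1 S1), and
    the product of the diagonal is the square root of det S1 / det S2. *)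
Definition gauss_div (B : 'M[R]_m) : R :=
  - ln (\prod_i B i i) + (frob2 B - m%:R) / 2.

Lemma ln_gauss_dens x : ln (gauss_dens S1 S2 (tvec (L1 *m cvec x))) =
  (- ln (\prod_i A i i) + (sqnorm (A *m cvec x) - sqnorm (cvec x)) / 2)%R.
Proof.
rewrite /gauss_dens /gauss_ratio tvecK subr0.
rewrite (_ : invmx L2 *m (L1 *m cvec x) = A *m cvec x); last by rewrite mulmxA.
rewrite mulKmx; last first.
  by apply: trig_pos_unitmx; [exact: transfer_trig|exact: transfer_pos].
have p0 : (0 < \prod_i A i i)%R by apply: prodr_gt0 => i _; exact: transfer_pos.
by rewrite lnM ?posrE ?invr_gt0 ?expR_gt0 // lnV ?posrE // expRK.
Qed.

Lemma std_normal_integrable_sqnorm n (B : 'M[R]_(n, m)) :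
  (std_normal m).-integrable setT (fun x => (sqnorm (B *m cvec x))%:E).
Proof.
apply/integrableP; split.
  apply/measurable_EFinP; apply: measurable_sqnorm => i.
  by apply: measurable_mulmx => j; exact: measurable_cvec.
under eq_integral do rewrite /= ger0_norm ?sqnorm_ge0 //.
by rewrite std_normal_sqnorm ltry.
Qed.

Lemma integral_ln_gauss_dens :
  (normal_law S1).-integrable setT (fun x => (ln (gauss_dens S1 S2 x))%:E) /\
  \int[normal_law S1]_x (ln (gauss_dens S1 S2 x))%:E = (gauss_div A)%:E.
Proof.
have mln : measurable_fun setT (fun x => (ln (gauss_dens S1 S2 x))%:E).
  apply/measurable_EFinP/measurableT_comp; first exact: measurable_ln.
  exact: measurable_gauss_dens.
have iA := std_normal_integrable_sqnorm A.
have i1 := std_normal_integrable_sqnorm (1%:M : 'M[R]_m).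
pose c := (- ln (\prod_i A i i))%R.
have ic : (std_normal m).-integrable setT (cst c%:E).
  exact: finite_measure_integrable_cst.
have iAB := integrableB measurableT iA i1.
have iZ := integrableZl measurableT 2^-1 iAB.
have E x : (ln (gauss_dens S1 S2 (tvec (L1 *m cvec x))))%:E = c%:E +
    2^-1%:E * ((sqnorm (A *m cvec x))%:E - (sqnorm (1%:M *m cvec x))%:E).
  by rewrite ln_gauss_dens mul1mx -EFinB -EFinM -EFinD [(2^-1 * _)%R]mulrC.
split.
  apply/(image_law_integrable (@measurable_act m m L1) (P := std_normal m)) => //.
    by move=> F mF F0; exact: normal_law_integral.
  under eq_fun do rewrite E.
  exact: integrableD.
rewrite normal_law_integral_fun //; under eq_integral do rewrite E.
rewrite integralD // integral_prob_cst integralZl // integralB //.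
rewrite !std_normal_sqnorm -EFinB -EFinM -EFinD /gauss_div -/c.
have -> : frob2 (1%:M : 'M[R]_m) = m%:R.
  rewrite /frob2 (eq_bigr (fun=> 1%R)) => [|i _].
    by rewrite sumr_const card_ord.
  rewrite (bigD1 i) //= big1 => [|j ji]; first by rewrite mxE eqxx expr1n addr0.
  by rewrite mxE eq_sym (negbTE ji) expr0n.
by rewrite [(2^-1 * _)%R]mulrC.
Qed.

Lemma Idiv_posdef : Idiv S1 S2 = (gauss_div A)%:E.
Proof.
rewrite /Idiv (KL_density (@measurable_gauss_dens m S1 S2)) => [|B mB].
  rewrite -(proj2 integral_ln_gauss_dens); apply: eq_integral => x _.
  by rewrite lne_EFin // gauss_dens_gt0.
exact: gauss_dens_set.
Qed.

End TwoLaws.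

(* A singular normal law is carried by a hyperplane, which a nonsingular one does
   not charge fully, since [u . X] has positive variance. *)
Lemma normal_law_dominates m (S1 S2 : 'M[R]_m) : posdef_mx S1 ->
  covariance_mx S2 -> normal_law S1 `<< normal_law S2 -> posdef_mx S2.
Proof.
move=> p1 c2 /null_content_dominatesP dom; apply: contrapT => np2.
have [u u0 uL] := not_posdef_null c2 np2.
pose q (x : m.-tuple R) := ((u^T *m cvec x) 0 0)%R.
have mq : measurable_fun setT q.
  by apply: measurable_mulmx => i; exact: measurable_cvec.
pose B := [set x | q x != 0%R].
have mB : measurable B.
  rewrite (_ : B = q @^-1` [set~ 0%R]); last first.
    by apply/seteqP; split=> x /= /eqP.
  by rewrite -[X in measurable X]setTI; apply: mq => //; exact: measurableC.
have lawB (S : 'M[R]_m) : normal_law S B =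
    \int[std_normal m]_x (\1_B (tvec (chol S *m cvec x)))%:E.
  rewrite -(@normal_law_integral m S (fun x => (\1_B x)%:E)) //.
    by rewrite integral_indic // setIT.
  by apply/measurable_EFinP; exact: measurable_indic.
have P2 : normal_law S2 B = 0.
  rewrite lawB integral0_eq // => x _; rewrite indicE /B /= memNset //= => /eqP.
  by apply; rewrite /q tvecK mulmxA uL mul0mx mxE.
have P1 := dom _ mB P2.
have w0 : (chol S1)^T *m u != 0%R.
  apply: contra_neq u0 => h.
  by rewrite -[u](mulKmx (_ : (chol S1)^T \in unitmx)) ?h ?mulmx0 ?unitmx_tr ?chol_unit.
have := std_normal_affine_sqr ((chol S1)^T *m u) 0.
have : \int[normal_law S1]_x ((q x) ^+ 2)%:E = 0.
  have mq2 : measurable_fun setT (fun x => ((q x) ^+ 2)%:E).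
    by apply/measurable_EFinP; exact: measurable_funX.
  rewrite (ae_eq_integral (cst 0)) ?integral_cst ?mul0e //.
  exists B; split => // x /= /not_implyP[_] h; apply/eqP => q0; apply: h.
  by rewrite q0 expr0n.
rewrite normal_law_integral //; last 2 first.
- by apply/measurable_EFinP; exact: measurable_funX.
- by move=> x; rewrite lee_fin sqr_ge0.
rewrite expr0n /= add0r => h1 h2; case/negP: w0; apply/eqP/colP => i; rewrite [RHS]mxE.
have : (sqnorm ((chol S1)^T *m u))%:E = 0.
  rewrite -h2 -{}h1; apply: eq_integral => x _.
  by rewrite add0r /q tvecK trmx_mul trmxK mulmxA.
case=> /eqP; rewrite psumr_eq0 => [/allP/(_ i)|j _]; last exact: sqr_ge0.
by rewrite mem_index_enum sqrf_eq0 => /(_ isT)/eqP.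
Qed.

End NormalLaws.

(** * Splitting a normal law into its first n and last k coordinates *)

Section Marginals.
Context {R : realType}.

Lemma cvec_cat n k (x : n.-tuple R) (y : k.-tuple R) :
  cvec [tuple of x ++ y] = col_mx (cvec x) (cvec y).
Proof.
apply/colP => i; case: (split_ordP i) => j ->.
  by rewrite col_mxEu !mxE tnth_lshift.
by rewrite col_mxEd !mxE tnth_rshift.
Qed.

Lemma measurable_cat d (T : measurableType d) n k
    (f : T -> n.-tuple R) (g : T -> k.-tuple R) :
  measurable_fun setT f -> measurable_fun setT g ->
  measurable_fun setT (fun t => [tuple of f t ++ g t]).
Proof.
move=> mf mg; apply/measurable_fun_tnthP => i; case: (split_ordP i) => j ->.
  rewrite (_ : _ \o _ = fun t => tnth (f t) j).
    exact: (measurableT_comp (measurable_tnth j) mf).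
  by apply/funext => t /=; rewrite tnth_lshift.
rewrite (_ : _ \o _ = fun t => tnth (g t) j).
  exact: (measurableT_comp (measurable_tnth j) mg).
by apply/funext => t /=; rewrite tnth_rshift.
Qed.

Lemma measurable_section_integral d d' (T : measurableType d) (T' : measurableType d')
    (mu : probability T' R) (F : T * T' -> \bar R) :
  measurable_fun setT F -> (forall z, 0 <= F z) ->
  measurable_fun setT (fun x => \int[mu]_y F (x, y)).
Proof. by move=> mF F0; exact: measurable_fun_fubini_tonelli_F. Qed.

Lemma std_normal_cat n k (F : (n + k).-tuple R -> \bar R) :
  measurable_fun setT F -> (forall x, 0 <= F x) ->
  \int[std_normal (n + k)]_x F x =
  \int[std_normal n]_x \int[std_normal k]_y F [tuple of x ++ y].
Proof.
have mint m (G : (m + k).-tuple R -> \bar R) :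
    measurable_fun setT G -> (forall x, 0 <= G x) ->
    measurable_fun setT (fun x : m.-tuple R => \int[std_normal k]_y G [tuple of x ++ y]).
  move=> mG G0; pose H (x : m.-tuple R) (y : k.-tuple R) := G [tuple of x ++ y].
  have mG' : measurable_fun setT (fun xy : m.-tuple R * k.-tuple R => H xy.1 xy.2).
    by apply: (measurableT_comp mG); exact: measurable_cat.
  exact: (@measurable_section_integral _ _ _ _ (std_normal k) _ mG' (fun z => G0 _)).
elim: n F => [|n IH] F mF F0.
  rewrite integral_std_normal0; last exact: mint.
  by apply: eq_integral => y _; congr F; exact: val_inj.
rewrite [RHS]std_normal_recl; last 2 first.
- exact: mint.
- by move=> x; exact: integral_ge0.
rewrite (@std_normal_recl _ (n + k) F) //; apply: eq_integral => z _.
have mFz : measurable_fun setT (fun x : (n + k).-tuple R => F [tuple of z :: x]).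
  by apply: (measurableT_comp mF); exact: measurable_cons.
rewrite (IH _ mFz (fun x => F0 _)).
by apply: eq_integral => x _; apply: eq_integral => y _; congr F; exact: val_inj.
Qed.

Definition tproj n k (x : (n + k).-tuple R) : n.-tuple R := tvec (usubmx (cvec x)).

Lemma measurable_tproj n k : measurable_fun setT (@tproj n k).
Proof.
apply: measurable_tvec => i.
rewrite (_ : (fun _ => _) = fun t => cvec t (lshift k i) 0%R).
  exact: measurable_cvec.
by apply/funext => t; rewrite mxE.
Qed.

Lemma normal_law_block n k (S : 'M[R]_(n + k)) A B C (F : (n + k).-tuple R -> \bar R) :
  chol S = block_mx A 0 B C -> measurable_fun setT F -> (forall x, 0 <= F x) ->
  \int[normal_law S]_z F z = \int[std_normal n]_x \int[std_normal k]_y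
    F (tvec (col_mx (A *m cvec x) (B *m cvec x + C *m cvec y))).
Proof.
move=> ES mF F0; rewrite (normal_law_integral S mF F0).
have mFL := measurableT_comp mF (measurable_act (chol S)).
rewrite (std_normal_cat mFL (fun x => F0 _)).
apply: eq_integral => x _; apply: eq_integral => y _ /=.
by rewrite ES cvec_cat mul_block_col mul0mx addr0.
Qed.

(** The first n coordinates of L Z involve only the first n coordinates of Z, through the leading
    block of L, which is the factor of the leading block of S. *)
Lemma normal_law_marginal n k (S : 'M[R]_(n + k)) : covariance_mx S ->
  image_law (@tproj n k) (normal_law S) (normal_law (ulsubmx S)).
Proof.
move=> cS F mF F0; have [_ _ ur0] := chol_form_sub (chol_chol_form S).
have EL : chol S = block_mx (chol (ulsubmx S)) 0 (dlsubmx (chol S)) (drsubmx (chol S)).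
  by rewrite -chol_ulsub // -ur0 submxK.
rewrite normal_law_integral // (normal_law_block EL) //; last first.
  by apply: (measurableT_comp mF); exact: measurable_tproj.
apply: eq_integral => x _; under eq_integral do rewrite /tproj tvecK col_mxKu.
by rewrite integral_cst // [X in _ * X]probability_setT mule1.
Qed.

End Marginals.

(** * Comparison of the divergences of joint laws and of their marginals *)

Section SameConditional.
Context {R : realType}.
Variables (n k : nat) (S1 S2 : 'M[R]_n) (T1 T2 : 'M[R]_(n + k)).
Variables (B : 'M[R]_(k, n)) (C : 'M[R]_k).
Hypotheses (p1 : posdef_mx S1) (p2 : posdef_mx S2).
Local Notation L1 := (chol S1).
Local Notation L2 := (chol S2).
Hypothesis ET1 : chol T1 = block_mx L1 0 (B *m invmx L2 *m L1) C.
Hypothesis ET2 : chol T2 = block_mx L2 0 B C.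

(* Under both N(0, T1) and N(0, T2) the conditional law of the last k coordinates
   given the first n ones, x, is the law of [B L2^-1 x + C Z]. *)
Lemma same_conditional_integral (F : (n + k).-tuple R -> \bar R) :
  measurable_fun setT F -> (forall x, 0 <= F x) ->
  \int[normal_law T1]_z F z =
  \int[normal_law T2]_z (F z * (gauss_dens S1 S2 (tproj z))%:E).
Proof.
move=> mF F0.
pose K (x : n.-tuple R) (y : k.-tuple R) :=
  F (tvec (col_mx (cvec x) (B *m invmx L2 *m cvec x + C *m cvec y))).
have mK : measurable_fun setT (fun xy : n.-tuple R * k.-tuple R => K xy.1 xy.2).
  apply: (measurableT_comp mF); apply: measurable_tvec => i.
  case: (split_ordP i) => j ->.
    under eq_fun do rewrite col_mxEu; exact: measurable_cvec.
  under eq_fun do rewrite col_mxEd; apply: measurable_addmx => l.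
    by apply: measurable_mulmx => q; exact: measurable_cvec.
  by apply: measurable_mulmx => q; exact: measurable_cvec.
pose H x := \int[std_normal k]_y K x y.
have mH : measurable_fun setT H.
  exact: (@measurable_section_integral _ _ _ _ _ (std_normal k) _ mK (fun z => F0 _)).
have H0 x : 0 <= H x by apply: integral_ge0 => y _; exact: F0.
have mg : measurable_fun setT (EFin \o gauss_dens S1 S2).
  by apply/measurable_EFinP; exact: measurable_gauss_dens.
have g0 x : (0 <= gauss_dens S1 S2 x)%R by rewrite ltW // gauss_dens_gt0.
have mgp : measurable_fun setT
    (fun z : (n + k).-tuple R => (gauss_dens S1 S2 (tproj z))%:E).
  exact: (measurableT_comp mg (@measurable_tproj _ n k)).
transitivity (\int[normal_law S1]_x H x).
  rewrite (normal_law_block ET1 mF F0) (normal_law_integral S1 mH H0).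
  apply: eq_integral => x _; apply: eq_integral => y _.
  by rewrite /K tvecK mulmxA.
have mHg := emeasurable_funM mH mg.
have Hg0 x : 0 <= H x * (gauss_dens S1 S2 x)%:E by rewrite mule_ge0 ?lee_fin.
have mFg := emeasurable_funM mF mgp.
have Fg0 z : 0 <= F z * (gauss_dens S1 S2 (tproj z))%:E by rewrite mule_ge0 ?lee_fin.
rewrite (gauss_dens_integral p1 p2 mH H0) (normal_law_integral S2 mHg Hg0).
rewrite (normal_law_block ET2 mFg Fg0).
apply: eq_integral => x _; set u := tvec (L2 *m cvec x).
have mKu : measurable_fun setT (K u) by exact: (measurableT_comp mK (pair1_measurable u)).
have gu0 : 0 <= (gauss_dens S1 S2 u)%:E by rewrite lee_fin.
apply: (eq_trans (esym (@ge0_integralZr _ _ _ (std_normal k) setT measurableT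
  (K u) mKu _ (fun y _ => F0 _) gu0))).
apply: eq_integral => y _; rewrite /K /tproj /u !tvecK col_mxKu.
by rewrite -[B *m _ *m _]mulmxA mulKmx // chol_unit.
Qed.

Lemma same_conditional_Idiv : covariance_mx T1 -> ulsubmx T1 = S1 ->
  Idiv T1 T2 = Idiv S1 S2.
Proof.
move=> c1 E1.
have mg := @measurable_gauss_dens R n S1 S2.
have mgp : measurable_fun setT
    (fun z : (n + k).-tuple R => (gauss_dens S1 S2 (tproj z))).
  exact: (measurableT_comp mg (@measurable_tproj _ n k)).
rewrite /Idiv (KL_density mgp) => [|U mU].
  rewrite (KL_density mg); last exact: gauss_dens_set.
  have := normal_law_marginal c1; rewrite E1 => /image_law_integral.
  move=> /(_ (fun x => lne (gauss_dens S1 S2 x)%:E)) -> //.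
  exact: measurable_lne_EFin mg.
have -> : normal_law T1 U = \int[normal_law T1]_x (\1_U x)%:E.
  by rewrite integral_indic // setIT.
rewrite same_conditional_integral //; last first.
  by apply/measurable_EFinP; exact: measurable_indic.
rewrite [RHS]integral_mkcond; apply: eq_integral => x _.
by rewrite epatch_indic muleC.
Qed.

End SameConditional.

Section MarginalDivergence.
Context {R : realType}.

Lemma Idiv_marginal_le n k (T1 T2 : 'M[R]_(n + k)) :
  covariance_mx T1 -> covariance_mx T2 -> posdef_mx (ulsubmx T1) ->
  Idiv (ulsubmx T1) (ulsubmx T2) <= Idiv T1 T2.
Proof.
move=> c1 c2 p1.
have m1 := normal_law_marginal c1; have m2 := normal_law_marginal c2.
have mp := @measurable_tproj R n k.
have [dom|ndom] := pselect (normal_law T1 `<< normal_law T2); last first.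
  by rewrite [leRHS]/Idiv /KL asboolF // leey.
(* Domination passes to the marginals and makes the leading block of T2 nonsingular, so the
   marginals have an explicit density even when T2 is singular. *)
have p2 : posdef_mx (ulsubmx T2).
  apply: (normal_law_dominates p1); first exact: covariance_ulsub.
  exact: (image_law_dominates mp m1 m2).
rewrite Idiv_posdef // -(proj2 (integral_ln_gauss_dens p1 p2)).
apply: (KL_data_processing mp m1 m2).
- exact: measurable_gauss_dens.
- by move=> y; exact: gauss_dens_gt0.
- by move=> A mA; exact: gauss_dens_set.
- exact: (proj1 (integral_ln_gauss_dens p1 p2)).
Qed.

End MarginalDivergence.

Local Close Scope ereal_scope.

(** * Continuity and coercivity of the divergence *)

Section Continuity.
Context {R : realType}.

Lemma continuous_sumr (T : topologicalType) (I : finType) (F : I -> T -> R) x :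
  (forall i, {for x, continuous (F i)}) -> {for x, continuous (fun x => \sum_i F i x)}.
Proof.
move=> cF; rewrite (_ : (fun _ => _) = \sum_i F i); last first.
  by apply/funext => y; rewrite fct_sumE.
apply: (big_ind (fun f : T -> R => {for x, continuous f})) => [|f g cf cg|i _].
- exact: cvg_cst.
- exact: continuousD.
- exact: cF.
Qed.

Lemma continuous_mulr (T : topologicalType) (f g : T -> R) :
  continuous f -> continuous g -> continuous (fun x => f x * g x).
Proof. by move=> cf cg x; apply: continuousM; [exact: cf|exact: cg]. Qed.

Lemma continuous_addr (T : topologicalType) (f g : T -> R) :
  continuous f -> continuous g -> continuous (fun x => f x + g x).
Proof. by move=> cf cg x; apply: continuousD; [exact: cf|exact: cg]. Qed.

Lemma continuous_cstr (T : topologicalType) (c : R) : continuous (fun _ : T => c).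
Proof. by move=> x; exact: cvg_cst. Qed.

(* Entrywise continuity suffices here and avoids putting a topology on matrices. *)
Definition mx_continuous (T : topologicalType) m n (f : T -> 'M[R]_(m, n)) : Prop :=
  forall i j, continuous (fun x => f x i j).

Lemma mx_continuous_cst (T : topologicalType) m n (A : 'M[R]_(m, n)) :
  mx_continuous (fun _ : T => A).
Proof. by move=> i j; exact: continuous_cstr. Qed.

Lemma mx_continuous_mul (T : topologicalType) m n p (f : T -> 'M[R]_(m, n))
    (g : T -> 'M[R]_(n, p)) :
  mx_continuous f -> mx_continuous g -> mx_continuous (fun x => f x *m g x).
Proof.
move=> cf cg i j; under eq_fun do rewrite mxE; move=> x; apply: continuous_sumr => l.
exact: continuous_mulr.
Qed.

Lemma mx_continuous_tr (T : topologicalType) m n (f : T -> 'M[R]_(m, n)) :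
  mx_continuous f -> mx_continuous (fun x => (f x)^T).
Proof. by move=> cf i j; under eq_fun do rewrite mxE; exact: cf. Qed.

Lemma mx_continuous_add (T : topologicalType) m n (f g : T -> 'M[R]_(m, n)) :
  mx_continuous f -> mx_continuous g -> mx_continuous (fun x => f x + g x).
Proof.
by move=> cf cg i j; under eq_fun do rewrite mxE; exact: continuous_addr.
Qed.

Lemma continuous_frob2 (T : topologicalType) m n (f : T -> 'M[R]_(m, n)) :
  mx_continuous f -> continuous (fun x => frob2 (f x)).
Proof.
move=> cf x; apply: continuous_sumr => i; apply: continuous_sumr => j.
by apply: (continuous_mulr (cf i j) (cf i j)).
Qed.

End Continuity.

Section Coercivity.
Context {R : realType}.

Lemma frob2_eq0 m n (A : 'M[R]_(m, n)) : frob2 A = 0 -> A = 0.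
Proof.
move=> /eqP; rewrite psumr_eq0 => [/allP h|i _]; last first.
  by apply: sumr_ge0 => j _; exact: sqr_ge0.
apply/matrixP => i j; have := h i; rewrite mem_index_enum => /(_ isT)/=.
rewrite psumr_eq0 => [/allP/(_ j)|l _]; last exact: sqr_ge0.
by rewrite mem_index_enum sqrf_eq0 mxE => /(_ isT)/eqP.
Qed.

Lemma ln_le_sqr4 (t : R) : 0 < t -> ln t <= t ^+ 2 / 4.
Proof.
move=> t0; have := @le_ln1Dx R (t - 1); rewrite addrCA subrr addr0.
by have := sqr_ge0 (t / 2 - 1) => ? h; have := h _; lra.
Qed.

Lemma ln_prod (I : Type) (r : seq I) (F : I -> R) : (forall i, 0 < F i) ->
  ln (\prod_(i <- r) F i) = \sum_(i <- r) ln (F i).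
Proof.
move=> F0; elim: r => [|i r IH]; first by rewrite !big_nil ln1.
by rewrite !big_cons lnM ?posrE ?prodr_gt0 // IH.
Qed.

Lemma gauss_div_sum m (A : 'M[R]_m) : pos_diag A ->
  gauss_div A = - (\sum_i ln (A i i)) + (frob2 A - m%:R) / 2.
Proof. by move=> pA; rewrite /gauss_div ln_prod. Qed.

(** The divergence is a sum over rows of terms t i >= 0, so each is at most c. Dropping the squares
    gives - ln (A i i) <= c + 1/2. Bounding ln (A i i) by a quarter of the sum s of squares of row i
    gives s <= 4 c + 2, and |x| <= 1 + x^2 adds 1. *)
Lemma gauss_div_coercive m (A : 'M[R]_m) (c : R) : pos_diag A -> gauss_div A <= c ->
  (forall i, expR (- c - 2^-1) <= A i i) /\
  (forall i j, `|A i j| <= 4 * c + 3).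
Proof.
move=> pA; pose t i := - ln (A i i) + (\sum_j A i j ^+ 2 - 1) / 2.
have -> : gauss_div A = \sum_i t i.
  rewrite gauss_div_sum // /t big_split /= sumrN -mulr_suml sumrB sumr_const.
  by rewrite card_ord.
have rowA i j : A i j ^+ 2 <= \sum_l A i l ^+ 2.
  by rewrite (bigD1 j) //= lerDl sumr_ge0 // => l _; exact: sqr_ge0.
have t0 i : 0 <= t i.
  have := @le_ln1Dx R (A i i - 1); rewrite addrCA subrr addr0.
  have := rowA i i; have := sqr_ge0 (A i i - 1); have := pA i.
  by rewrite /t => ? ? ? h; have := h _; lra.
move=> tc; have {}tc i : t i <= c.
  by apply: le_trans tc; rewrite (bigD1 i) //= lerDl sumr_ge0.
split=> [i|i j].
  rewrite -[leRHS]lnK ?posrE ?pA // ler_expR.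
  have := tc i; have : 0 <= \sum_j A i j ^+ 2 by exact: le_trans (sqr_ge0 _) (rowA i i).
  by rewrite /t; lra.
apply: le_trans (normr_le_1Dsqr _) _.
have := tc i; have := rowA i j; have := rowA i i; have := ln_le_sqr4 (pA i).
by rewrite /t; lra.
Qed.

End Coercivity.

(** * Existence of a minimizer by compactness *)

Section Minimum.
Context {R : realType}.
Variables (n k : nat) (Shat : 'M[R]_n).
Hypothesis Shat_pd : posdef_mx Shat.
Local Notation L1 := (chol Shat).
Local Notation W := (invmx L1).

(* The matrix [S = H H^T + D] is encoded by [A = (chol S)^-1 chol Shat], on which
   the divergence is coercive, together with [K = A W H], whose entries are bounded,
   and [d], the diagonal of [D]; the constraint says [A W S W^T A^T = 1]. *)
Definition factor_defect (A : 'M[R]_n) (K : 'M[R]_(n, k)) (d : 'rV[R]_n) : 'M[R]_n :=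
  K *m K^T + A *m W *m diag_mx d *m (A *m W)^T - 1%:M.

Lemma nonneg_diagP (D : 'M[R]_n) : nonneg_diag D ->
  exists2 d : 'rV[R]_n, D = diag_mx d & forall i, 0 <= d 0 i.
Proof.
move=> [dD D0]; have /diag_mxP[d E] := dD; exists d => // i.
by have := D0 i; rewrite E mxE eqxx mulr1n.
Qed.

Lemma gram_diag_covariance (H : 'M[R]_(n, k)) (D : 'M[R]_n) :
  nonneg_diag D -> covariance_mx (H *m H^T + D).
Proof.
move=> /nonneg_diagP[d -> d0]; split=> [|u].
  by rewrite linearD /= trmx_mul trmxK tr_diag_mx.
rewrite mulmxDr mulmxDl mxE addr_ge0 ?quad_gram_ge0 //.
rewrite mul_mx_diag mxE sumr_ge0 // => i _; rewrite !mxE.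
by rewrite mulrAC mulr_ge0 // -expr2 sqr_ge0.
Qed.

Lemma chol_of_whitening (M S : 'M[R]_n) :
  is_trig_mx M -> pos_diag M -> M *m S *m M^T = 1%:M -> chol S = invmx M.
Proof.
move=> tM pM E; have uM := trig_pos_unitmx tM pM.
have -> : S = invmx M *m (invmx M)^T.
  have uMt : M^T \in unitmx by rewrite unitmx_tr.
  rewrite trmx_inv -[LHS](mulKmx uM) -[M *m S](mulmxK uMt) E mul1mx.
  by [].
apply: chol_uniq; apply: pos_diag_chol_form; first exact: trig_invmx.
by move=> i; rewrite trig_invmx_diag // invr_gt0.
Qed.

(** Decoding: M = A W plays the role of the inverse of chol S, hence H = M^-1 K. The constraint says
    that M whitens H H^T + D, which forces chol S = M^-1. *)
Lemma factor_attained (A : 'M[R]_n) (K : 'M[R]_(n, k)) (d : 'rV[R]_n) :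
  is_trig_mx A -> pos_diag A -> (forall i, 0 <= d 0 i) ->
  factor_defect A K d = 0 ->
  exists (H : 'M[R]_(n, k)) (D : 'M[R]_n), [/\ nonneg_diag D, posdef_mx (H *m H^T + D) &
    Idiv Shat (H *m H^T + D) = (gauss_div A)%:E].
Proof.
move=> tA pA d0 /eqP; rewrite subr_eq0 => /eqP E.
have uL := chol_unit Shat_pd; have tL := trig_chol Shat.
have tM : is_trig_mx (A *m W) by rewrite trig_mulmx ?trig_invmx.
have pM : pos_diag (A *m W).
  move=> i; rewrite trig_mulmx_diag ?trig_invmx // trig_invmx_diag //.
  by rewrite mulr_gt0 ?invr_gt0 ?posdef_chol.
have uM := trig_pos_unitmx tM pM.
exists (invmx (A *m W) *m K), (diag_mx d).
have nd : nonneg_diag (diag_mx d).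
  by split=> [|i]; [exact: diag_mx_is_diag|rewrite mxE eqxx mulr1n].
set S := _ + _.
have cS : covariance_mx S by exact: gram_diag_covariance.
have ES : A *m W *m S *m (A *m W)^T = 1%:M.
  rewrite mulmxDr mulmxDl -E; congr (_ + _); rewrite !mulmxA mulmxV // mul1mx.
  rewrite -mulmxA -trmx_mul mulmxA mulmxV ?mul1mx //.
have EL := chol_of_whitening tM pM ES.
have pS : posdef_mx S by rewrite covariance_posdef_unit // EL unitmx_inv.
split=> //; rewrite Idiv_posdef // EL invmxK -mulmxA mulVmx ?mulmx1 //.
Qed.

Lemma factor_exists (H : 'M[R]_(n, k)) (D : 'M[R]_n) :
  nonneg_diag D -> posdef_mx (H *m H^T + D) ->
  let A := invmx (chol (H *m H^T + D)) *m L1 in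
  exists (K : 'M[R]_(n, k)) (d : 'rV[R]_n), (forall i, 0 <= d 0 i) /\ factor_defect A K d = 0.
Proof.
move=> nD pS A; have [d ED d0] := nonneg_diagP nD.
have uL := chol_unit Shat_pd; have uS := chol_unit pS.
have AW : A *m W = invmx (chol (H *m H^T + D)) by rewrite mulmxK.
exists (A *m W *m H), d; split=> //; apply/eqP; rewrite subr_eq0; apply/eqP.
rewrite trmx_mul -ED mulmxA -[A *m W *m H *m H^T]mulmxA -mulmxDl -mulmxDr.
rewrite AW -{2}(cholP (posdef_covariance pS)) trmx_inv mulmxA mulVmx // mul1mx.
by rewrite mulmxV // unitmx_tr.
Qed.

(** The i-th diagonal entry of the constraint writes 1 as the sum of all K i j ^+ 2 and all d 0 j *
    (A W) i j ^+ 2, which are nonnegative. *)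
Lemma factor_bounds (A : 'M[R]_n) (K : 'M[R]_(n, k)) (d : 'rV[R]_n) :
  (forall i, 0 <= d 0 i) -> factor_defect A K d = 0 ->
  (forall i j, `|K i j| <= 2) /\ (forall i, d 0 i * ((A *m W) i i) ^+ 2 <= 1).
Proof.
move=> d0 /eqP; rewrite subr_eq0 => /eqP; set M := A *m W => /matrixP E.
have diagE i : \sum_j K i j ^+ 2 + \sum_j d 0 j * M i j ^+ 2 = 1.
  have -> : 1 = (1%:M : 'M[R]_n) i i by rewrite mxE eqxx.
  rewrite -E mul_mx_diag [RHS]mxE [X in _ = X + _]mxE [X in _ = _ + X]mxE.
  congr (_ + _); apply: eq_bigr => j _; rewrite [_^T _ _]mxE //.
  by rewrite [X in _ = X * _]mxE; ring.
have Kp i : 0 <= \sum_j K i j ^+ 2 by rewrite sumr_ge0 // => j _; exact: sqr_ge0.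
have dp i : 0 <= \sum_j d 0 j * M i j ^+ 2.
  by rewrite sumr_ge0 // => j _; rewrite mulr_ge0 ?sqr_ge0.
split=> [i j|i].
  apply: le_trans (normr_le_1Dsqr _) _.
  have : K i j ^+ 2 <= \sum_l K i l ^+ 2.
    by rewrite (bigD1 j) //= lerDl sumr_ge0 // => l _; exact: sqr_ge0.
  by have := diagE i; have := dp i; lra.
have : d 0 i * M i i ^+ 2 <= \sum_l d 0 l * M i l ^+ 2.
  by rewrite (bigD1 i) //= lerDl sumr_ge0 // => l _; rewrite mulr_ge0 ?sqr_ge0.
by have := diagE i; have := Kp i; lra.
Qed.

(** One real coordinate per entry of A, K and d, so that boxes are products of segments, compact by
    Tychonoff's theorem. *)
Let I : finType := ('I_n * 'I_n + 'I_n * 'I_k + 'I_n)%type.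
Let T := prod_topology (fun _ : I => R).

Let toA (f : T) : 'M[R]_n := \matrix_(i, j) f (inl (inl (i, j))).
Let toK (f : T) : 'M[R]_(n, k) := \matrix_(i, j) f (inl (inr (i, j))).
Let tod (f : T) : 'rV[R]_n := \row_i f (inr i).
Let encode (A : 'M[R]_n) (K : 'M[R]_(n, k)) (d : 'rV[R]_n) : T := fun x =>
  match x with
  | inl (inl ij) => A ij.1 ij.2
  | inl (inr ij) => K ij.1 ij.2
  | inr i => d 0 i
  end.

Let toA_encode A K d : toA (encode A K d) = A.
Proof. by apply/matrixP => i j; rewrite mxE. Qed.

Let toK_encode A K d : toK (encode A K d) = K.
Proof. by apply/matrixP => i j; rewrite mxE. Qed.

Let tod_encode A K d : tod (encode A K d) = d.
Proof. by apply/rowP => i; rewrite mxE. Qed.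

Let continuous_coord (x : I) (g : T -> R) : (forall f, g f = f x) -> continuous g.
Proof.
by move=> gE; rewrite (funext gE); exact: (@proj_continuous I (fun=> R) x).
Qed.

Let toA_continuous : mx_continuous toA.
Proof. by move=> i j; apply: continuous_coord => f; rewrite mxE. Qed.

Let toK_continuous : mx_continuous toK.
Proof. by move=> i j; apply: continuous_coord => f; rewrite mxE. Qed.

Let diag_continuous : mx_continuous (fun f => diag_mx (tod f)).
Proof.
move=> i j; have [ij|ij] := eqVneq i j.
  by apply: (@continuous_coord (inr i)) => f; rewrite !mxE ij eqxx.
rewrite (_ : (fun _ => _) = fun _ : T => 0); first exact: continuous_cstr.
by apply/funext => f; rewrite !mxE (negbTE ij).
Qed.

Let defect_continuous :
  mx_continuous (fun f => factor_defect (toA f) (toK f) (tod f)).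
Proof.
apply: mx_continuous_add; last exact: mx_continuous_cst.
have cM := mx_continuous_mul toA_continuous (@mx_continuous_cst R T _ _ W).
apply: mx_continuous_add.
  exact: mx_continuous_mul toK_continuous (mx_continuous_tr toK_continuous).
exact: mx_continuous_mul (mx_continuous_mul cM diag_continuous) (mx_continuous_tr cM).
Qed.

Lemma gauss_div_min (c : R) :
  let feasible (A : 'M[R]_n) := [/\ is_trig_mx A, pos_diag A &
    exists (K : 'M[R]_(n, k)) (d : 'rV[R]_n),
      (forall i, 0 <= d 0 i) /\ factor_defect A K d = 0] in
  (exists2 A, feasible A & gauss_div A <= c) ->
  exists2 A, feasible A & forall A', feasible A' -> gauss_div A' <= c ->
    gauss_div A <= gauss_div A'.
Proof.
move=> feasible [A0 fA0 A0c].
pose del := expR (- c - 2^-1); have del0 : 0 < del by exact: expR_gt0.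
pose b := 4 * c + 3.
(* Above the diagonal of A both bounds are 0, which encodes triangularity. The bound [del] on the
   diagonal keeps the logarithm continuous. The bounds on A come from [gauss_div_coercive], those on
   K and d from [factor_bounds] with A i i >= [del]. *)
pose lo (x : I) : R := match x with
  | inl (inl (i, j)) => if i == j then del else if (i < j)%N then 0 else - b
  | inl (inr _) => - 2
  | inr _ => 0
  end.
pose hi (x : I) : R := match x with
  | inl (inl (i, j)) => if (i < j)%N then 0 else b
  | inl (inr _) => 2
  | inr i => ((del * W i i) ^+ 2)^-1
  end.
pose box : set T := [set f | forall x, f x \in `[lo x, hi x]].
pose X : set T := box `&`
  [set f | frob2 (factor_defect (toA f) (toK f) (tod f)) = 0].
have boxA f : box f -> is_trig_mx (toA f) /\ (forall i, del <= toA f i i).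
  move=> bf; split=> [|i].
    apply/is_trig_mxP => i j ij; rewrite mxE; have := bf (inl (inl (i, j))).
    rewrite in_itv /= ij; case: eqVneq ij => [->|_ _]; first by rewrite ltnn.
    by rewrite -eq_le => /eqP.
  by have := bf (inl (inl (i, i))); rewrite mxE in_itv /= eqxx => /andP[].
have W0 i : 0 < W i i.
  by rewrite trig_invmx_diag ?trig_chol ?chol_unit // invr_gt0 posdef_chol.
have XE (A : 'M[R]_n) (K : 'M[R]_(n, k)) (d : 'rV[R]_n) :
    is_trig_mx A -> pos_diag A -> (forall i, 0 <= d 0 i) ->
    factor_defect A K d = 0 -> gauss_div A <= c -> X (encode A K d).
  move=> tA pA d0 E Ac; have [lA uA] := gauss_div_coercive pA Ac.
  have [bK bd] := factor_bounds d0 E; have /is_trig_mxP tA' := tA.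
  split; last first.
    by rewrite /= toA_encode toK_encode tod_encode E /frob2 big1 // => i _;
      rewrite big1 // => j _; rewrite mxE expr0n.
  case=> [[[i j]|[i j]]|i]; rewrite in_itv /=.
  - have := uA i j; rewrite ler_norml -/b => /andP[bl bu].
    move: bl bu; case: eqVneq => [<-|ij] bl bu; first by rewrite ltnn lA.
    by case: ltnP => lij; rewrite ?bl // tA' ?lexx.
  - by have := bK i j; rewrite ler_norml.
  - rewrite d0 /= -[leRHS]mul1r ler_pdivlMr ?exprn_gt0 ?mulr_gt0 //.
    apply: le_trans (bd i); rewrite ler_wpM2l //.
    rewrite trig_mulmx_diag ?trig_invmx ?trig_chol ?chol_unit //.
    apply: lerXn2r; rewrite ?nnegrE; try by apply: ltW; rewrite mulr_gt0.
    by rewrite ler_pM2r // lA.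
(* This form is continuous coordinate by coordinate, and it agrees with [gauss_div] where the
   diagonal is positive, hence on X. *)
pose cost f := - (\sum_i ln (toA f i i)) + (frob2 (toA f) - n%:R) / 2.
have cX : compact X.
  apply: compact_closedI.
    apply: (@tychonoff I (fun=> R) (fun x => [set` `[lo x, hi x]])) => x.
    exact: segment_compact.
  apply: (@preimage_closed T R (fun f => frob2 (factor_defect (toA f) (toK f) (tod f)))
    [set y | y = 0]).
    by move=> f _; apply: continuous_frob2 => //; exact: defect_continuous.
  exact: closed_eq.
have X0 : X !=set0.
  have [tA pA [K [d [d0 E]]]] := fA0.
  by exists (encode A0 K d); exact: XE.
have [f fX fmin] : exists2 f, f \in X & forall g, g \in X -> cost f <= cost g.
  apply: compact_EVT_min => //; apply: continuous_in_subspaceT => f fX.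
  have [_ lA] := boxA f (proj1 (set_mem fX)).
  have c1 : {for f, continuous (fun g => \sum_i ln (toA g i i))}.
    apply: continuous_sumr => i.
    apply: (@continuous_comp _ _ _ (fun f => toA f i i) (@ln R)).
      exact: toA_continuous.
    by apply: continuous_ln; exact: lt_le_trans (lA i).
  have c2 : continuous (fun g => (frob2 (toA g) - n%:R) / 2).
    apply: continuous_mulr; last exact: continuous_cstr.
    by apply: continuous_addr; [exact: continuous_frob2|exact: continuous_cstr].
  exact: (continuousD (continuousN c1) (c2 f)).
have [tA lA] := boxA f (proj1 (set_mem fX)).
have pA : pos_diag (toA f) by move=> i; exact: lt_le_trans (lA i).
exists (toA f).
  split=> //; exists (toK f), (tod f); split; last exact/frob2_eq0/(proj2 (set_mem fX)).
  by move=> i; have := (proj1 (set_mem fX)) (inr i); rewrite in_itv mxE /= => /andP[].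
move=> A [tA' pA' [K [d [d0 E]]]] Ac.
have := fmin (encode A K d) (mem_set (XE _ _ _ tA' pA' d0 E Ac)).
by rewrite /cost toA_encode -!gauss_div_sum.
Qed.

End Minimum.

(** * The optimal factor model and its lift to n + k coordinates *)

Section MinimalFactorModel.
Context {R : realType}.

Lemma Idiv_factor_min (n k : nat) (Shat : 'M[R]_n) : posdef_mx Shat ->
  exists (H : 'M[R]_(n, k)) (D : 'M[R]_n),
    [/\ nonneg_diag D, posdef_mx (H *m H^T + D) &
      forall (H' : 'M[R]_(n, k)) (D' : 'M[R]_n), nonneg_diag D' ->
        (Idiv Shat (H *m H^T + D) <= Idiv Shat (H' *m H'^T + D'))%E].
Proof.
move=> pS; have nd1 : nonneg_diag (1%:M : 'M[R]_n).
  by split=> [|i]; [exact: scalar_mx_is_diag|rewrite mxE eqxx].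
have p1 : posdef_mx ((0 : 'M[R]_(n, k)) *m 0^T + 1%:M).
  rewrite mul0mx add0r covariance_posdef_unit.
    by rewrite -[1%:M]mulmx1 -{2}trmx1 chol_uniq ?unitmx1 //;
      apply: pos_diag_chol_form => [|i]; rewrite ?scalar_mx_is_trig // mxE eqxx.
  by rewrite -[1%:M]mulmx1 -{2}trmx1; exact: gram_covariance.
have feas (H : 'M[R]_(n, k)) D : nonneg_diag D -> posdef_mx (H *m H^T + D) ->
    let A := invmx (chol (H *m H^T + D)) *m chol Shat in
    [/\ is_trig_mx A, pos_diag A & exists (K : 'M[R]_(n, k)) (d : 'rV[R]_n),
      (forall i, 0 <= d 0 i) /\ factor_defect Shat A K d = 0].
  move=> nD p; split; [exact: transfer_trig|exact: transfer_pos|].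
  exact: factor_exists.
(* The level c is the divergence at H = 0, D = 1, a nonsingular model. Competitors above this level
   cannot beat the minimizer, and singular ones have infinite divergence. *)
have [|A [tA pA [K [d [d0 E]]]] Amin] := @gauss_div_min R n k Shat pS
    (gauss_div (invmx (chol ((0 : 'M[R]_(n, k)) *m 0^T + 1%:M)) *m chol Shat)).
  by exists (invmx (chol ((0 : 'M[R]_(n, k)) *m 0^T + 1%:M)) *m chol Shat) => //;
    exact: feas.
have [H [D [nD p HD]]] := factor_attained pS tA pA d0 E.
exists H, D; split=> // H' D' nD'; rewrite HD.
have [p'|np'] := pselect (posdef_mx (H' *m H'^T + D')); last first.
  rewrite [leRHS]/Idiv /KL asboolF ?leey // => dom; apply: np'.
  by apply: normal_law_dominates dom => //; exact: gram_diag_covariance.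
rewrite Idiv_posdef // lee_fin.
have [le1|gt1] := lerP (gauss_div (invmx (chol (H' *m H'^T + D')) *m chol Shat))
    (gauss_div (invmx (chol ((0 : 'M[R]_(n, k)) *m 0^T + 1%:M)) *m chol Shat)).
  by apply: Amin => //; exact: feas.
by apply: le_trans (ltW gt1); apply: Amin => //; exact: feas.
Qed.

Lemma SigmaHDQ_covariance n k (H : 'M[R]_(n, k)) D (Q : 'M[R]_k) :
  nonneg_diag D -> covariance_mx (SigmaHDQ H D Q).
Proof.
move=> [dD D0].
(* The joint matrix is itself a factor model in dimension n + k, with loadings H over Q^T and a
   noise that vanishes on the last k coordinates. *)
have -> : SigmaHDQ H D Q =
    col_mx H Q^T *m (col_mx H Q^T)^T + block_mx D 0 0 0.
  rewrite tr_col_mx trmxK mul_col_row add_block_mx !addr0.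
  by rewrite /SigmaHDQ trmx_mul.
apply: gram_diag_covariance; split=> [|i].
  rewrite is_diag_block_mx // !eqxx dD /=; exact: mx0_is_diag.
by case: (split_ordP i) => j ->; rewrite ?block_mxEul ?block_mxEdr // mxE.
Qed.

(* Give the last coordinates the conditional law they have under N(0, T2). *)
Lemma Idiv_lift n k (S : 'M[R]_n) (T2 : 'M[R]_(n + k)) :
  posdef_mx S -> covariance_mx T2 -> posdef_mx (ulsubmx T2) ->
  exists2 T1 : 'M[R]_(n + k), Sigma0 k S T1 & Idiv T1 T2 = Idiv S (ulsubmx T2).
Proof.
move=> pS c2 p2; have [_ cC ur0] := chol_form_sub (chol_chol_form T2).
set B := dlsubmx (chol T2); set C := drsubmx (chol T2) in cC *.
have E2 : chol T2 = block_mx (chol (ulsubmx T2)) 0 B C.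
  by rewrite -chol_ulsub // -ur0 submxK.
pose T := block_mx (chol S) 0 (B *m invmx (chol (ulsubmx T2)) *m chol S) C.
have fT : chol_form T.
  by apply: chol_form_block => //; [exact: trig_chol|exact: posdef_chol].
have ul : ulsubmx (T *m T^T) = S.
  rewrite tr_block_mx mulmx_block block_mxKul trmx0 mul0mx addr0.
  by rewrite cholP //; exact: posdef_covariance.
exists (T *m T^T); first by split=> //; exact: gram_covariance.
apply: (same_conditional_Idiv pS p2 _ E2) => //; first exact: chol_uniq.
exact: gram_covariance.
Qed.

End MinimalFactorModel.

Theorem proposition4p2 (R : realType) (n k : nat) (Shat : 'M[R]_n)
    (k_gt0 : (0 < k)%N) (k_lt_n : (k < n)%N) (Shat_pd : posdef_mx Shat) :
  exists v : \bar R,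
    is_min [set Idiv Shat (H *m H^T + D) |
              H in [set: 'M[R]_(n, k)] & D in [set D : 'M[R]_n | nonneg_diag D]] v /\
    is_min [set Idiv S0 S1 | S0 in Sigma0 k Shat & S1 in Sigma1 R n k] v.
Proof.
have [H [D [nD p Hmin]]] := Idiv_factor_min k Shat_pd.
(* The leading block of Sigma(H, D, Q) does not depend on Q, so Q = 1 serves as witness. *)
have c1 : covariance_mx (SigmaHDQ H D 1%:M) by exact: SigmaHDQ_covariance.
have [|T1 T1in ET1] := Idiv_lift (T2 := SigmaHDQ H D 1%:M) Shat_pd c1.
  by rewrite block_mxKul.
exists (Idiv Shat (H *m H^T + D)); split; split.
- by exists H => //; exists D.
- by move=> _ [H' _ [D' nD' <-]]; exact: Hmin.
- exists T1 => //; exists (SigmaHDQ H D 1%:M); last by rewrite ET1 block_mxKul.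
  by exists H, D, 1%:M; split=> //; exact: unitmx1.
- move=> _ [S0 [cS0 S0E] [_ [H' [D' [Q [nD' _ ->]]]] <-]].
  apply: (le_trans (Hmin H' D' nD')).
  have := @Idiv_marginal_le R n k S0 (SigmaHDQ H' D' Q) cS0.
  by rewrite S0E block_mxKul; apply => //; exact: SigmaHDQ_covariance.
Qed.
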